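(* Consider the exponential-family multi-armed bandit: a fixed sampling rule $\Lambda$ chooses at each step $j=1,\dots,n$ an arm $x_j\in\{e_1,\dots,e_p\}$ (identified with $i\in\{1,\dots,p\}$) from $\Lambda(\cdot\mid H_{j-1})$, and then $y_j$ is drawn, conditionally on the past and $x_j$, from the one-parameter exponential family with density $\exp(\eta y-b(\eta))h(y)$ (with respect to a fixed base measure) at natural parameter $\eta=x_j^\top\beta_0$. Let $N_{n,i}$ be the number of pulls of arm $i$ in the first $n$ steps, $\bar Y_{n,i}=\frac1{N_{n,i}}\sum_{j=1}^n \mathbf{1}[x_j=e_i]y_j$, the local MLE $\hat\beta_{n,i}=\beta_{0,i}+\frac{\bar Y_{n,i}-b'(\beta_{0,i})}{b''(\beta_{0,i})}$, $\hat\beta_n=(\hat\beta_{n,1},\dots,\hat\beta_{n,p})$, and $I_n=\mathrm{diag}\{N_{n,i}\,b''(\beta_{0,i})\}_{i=1}^p$. Assume: (i) each $\beta_{0,i}$ lies in the interior of the natural parameter space; (ii) $\min_i N_{n,i}\xrightarrow{p}\infty$; (iii) the prior $\pi$ has a continuous and bounded density with $\pi(\beta_0)>0$. Then $$\big\|\pi(\cdot\mid H_n)-\mathcal{N}(\hat\beta_n,I_n^{-1})\big\|_{\mathrm{TV}}\xrightarrow{p}0.$$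
   Context: $H_j=((x_1,y_1),\dots,(x_j,y_j))$ is the history and the sampling rule $\Lambda$ maps any finite history to a probability distribution on $\{e_1,\dots,e_p\}$, and does not depend on $n$. The natural parameter space is $\{\eta:\int e^{\eta y}h(y)\,dy<\infty\}$ (integral w.r.t. the base measure), and $b$ is the log-partition function. The posterior is $\pi(\beta\mid H_n)\propto\pi(\beta)\prod_{j=1}^n\exp\big((x_j^\top\beta)y_j-b(x_j^\top\beta)\big)$ for $\beta$ with all coordinates in the natural parameter space (and the prior is supported there). $\|\cdot\|_{\mathrm{TV}}$ is total variation distance. *)

(* Defs.v *)
From HB Require Import structures.
From mathcomp Require Import all_boot all_order all_algebra.
From mathcomp Require Import all_classical all_reals all_analysis.
Set Implicit Arguments. Unset Strict Implicit. Unset Printing Implicit Defensive.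
Import Order.TTheory GRing.Theory Num.Theory.
Import numFieldNormedType.Exports.
Local Open Scope classical_set_scope.
Local Open Scope ring_scope.

Definition natparam (R : realType) (nu : {measure set R -> \bar R})
  (h : R -> R) : set R :=
  [set eta | (\int[nu]_y (expR (eta * y) * h y)%:E < +oo)%E].

(** log-partition function b(eta) = log int e^{eta y} h(y) nu(dy)
    (meaningful on the natural parameter space). *)
Definition logpart (R : realType) (nu : {measure set R -> \bar R})
  (h : R -> R) (eta : R) : R :=
  ln (fine (\int[nu]_y (expR (eta * y) * h y)%:E)).

Definition efdens (R : realType) (nu : {measure set R -> \bar R})
  (h : R -> R) (eta y : R) : R :=
  expR (eta * y - logpart nu h eta) * h y.

Definition history (R : realType) (p : nat) := seq ('I_p * R).

(** [histE nu h beta0 Lambda k H f] : expectation of [f] of the history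
    obtained by running [k] more steps of the bandit from the history [H]:
    at each step the arm i is drawn from [Lambda H'] and the reward y from
    the exponential family at natural parameter [beta0 i]. *)
Fixpoint histE (R : realType) (p : nat) (nu : {measure set R -> \bar R})
  (h : R -> R) (beta0 : 'I_p -> R) (Lambda : history R p -> 'I_p -> R)
  (k : nat) (H : history R p) (f : history R p -> \bar R) : \bar R :=
  match k with
  | 0 => f H
  | k'.+1 => (\sum_(i < p) (Lambda H i)%:E *
        \int[nu]_y ((efdens nu h (beta0 i) y)%:E *
                    histE nu h beta0 Lambda k' (rcons H (i, y)) f))%E
  end.

Definition probH (R : realType) (p : nat) (nu : {measure set R -> \bar R})
  (h : R -> R) (beta0 : 'I_p -> R) (Lambda : history R p -> 'I_p -> R)
  (n : nat) (E : history R p -> bool) : \bar R :=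
  histE nu h beta0 Lambda n [::] (fun H => (E H)%:R%:E).

(* ---- Lebesgue integral on R^p (iterated, nonnegative integrands) ---- *)

Fixpoint intRk (R : realType) (k : nat) (g : (nat -> R) -> \bar R) : \bar R :=
  match k with
  | 0 => g (fun _ => 0)
  | k'.+1 => (\int[@lebesgue_measure R]_t
                intRk k' (fun v => g (fun j => if j == k' then t else v j)))%E
  end.

Definition intRp (R : realType) (p : nat) (F : ('I_p -> R) -> \bar R) : \bar R :=
  intRk p (fun v => F (fun i => v (nat_of_ord i))).

Definition npulls (R : realType) (p : nat) (H : history R p) (i : 'I_p) : nat :=
  count (fun xy => xy.1 == i) H.

Definition ybar (R : realType) (p : nat) (H : history R p) (i : 'I_p) : R :=
  (\sum_(xy <- H | xy.1 == i) xy.2) / (npulls H i)%:R.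

Definition betahat (R : realType) (p : nat) (nu : {measure set R -> \bar R})
  (h : R -> R) (beta0 : 'I_p -> R) (H : history R p) (i : 'I_p) : R :=
  let b := logpart nu h in
  beta0 i + (ybar H i - derive1 b (beta0 i)) / derive1 (derive1 b) (beta0 i).

Definition lik (R : realType) (p : nat) (nu : {measure set R -> \bar R})
  (h : R -> R) (H : history R p) (beta : 'I_p -> R) : R :=
  \prod_(xy <- H) expR (beta xy.1 * xy.2 - logpart nu h (beta xy.1)).

Definition posterior (R : realType) (p : nat) (nu : {measure set R -> \bar R})
  (h : R -> R) (prior : ('I_p -> R) -> R) (H : history R p)
  (beta : 'I_p -> R) : R :=
  prior beta * lik nu h H beta /
  fine (intRp (fun b => (prior b * lik nu h H b)%:E)).

Definition gaussdens (R : realType) (p : nat) (nu : {measure set R -> \bar R})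
  (h : R -> R) (beta0 : 'I_p -> R) (H : history R p) (beta : 'I_p -> R) : R :=
  \prod_(i < p)
    (let s := (npulls H i)%:R * derive1 (derive1 (logpart nu h)) (beta0 i) in
     Num.sqrt (s / (2 * pi)) *
       expR (- (s * (beta i - betahat nu h beta0 H i) ^+ 2) / 2)).

Definition tvdist (R : realType) (p : nat) (nu : {measure set R -> \bar R})
  (h : R -> R) (beta0 : 'I_p -> R) (prior : ('I_p -> R) -> R)
  (H : history R p) : \bar R :=
  ((2^-1)%:E * intRp (fun beta =>
     `|posterior nu h prior H beta - gaussdens nu h beta0 H beta|%:E))%E.

(* Main.v *)
(** The integral of a nonnegative function is a supremum over simple functions
    below it, hence monotone without any measurability; so it suffices to
    dominate everything pointwise by sums of products of one-dimensional
    functions, and by explicit supermartingales on histories.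

    Probabilistic part: for [lam] small, the exponential of
    [sum_(pulls of arm i) (lam y - (b (beta0_i + lam) - b beta0_i))] has
    expectation one.  A union bound over the value [m] of [N_(n,i)], with
    [lam = +- m^(-2/5)], shows that outside an event of small probability the
    centered reward sums satisfy [|S_i| <= C_i N_i^(3/5)] for all arms, provided
    that all [N_i] exceed a large constant.  Adaptive sampling does not make
    [S_i / sqrt N_i] tight, but this weaker bound is enough.

    Deterministic part: under that bound, with [q = N_i^(1/5)], the likelihood
    of arm [i] is within a factor [1 + O(1/q)] of the Gaussian on the window
    [|t - beta0_i| <= rho] with [rho] of order [q^-2], by a third order Taylor
    expansion of [b]; outside, convexity of [b] bounds it by
    [exp (- k |t - beta0_i|)] with [k] of order [q^3], whose mass is negligible
    against the Gaussian normalization, of order [q^(5/2)]. *)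

Require Import Defs.
From HB Require Import structures.
From mathcomp Require Import all_boot all_order all_algebra.
From mathcomp Require Import all_classical all_reals all_analysis.
From mathcomp Require Import measurable_realfun.
From mathcomp Require Import ring lra.
Set Implicit Arguments.
Unset Strict Implicit.
Unset Printing Implicit Defensive.
Import Order.TTheory GRing.Theory Num.Theory.
Import numFieldNormedType.Exports.
Local Open Scope classical_set_scope.
Local Open Scope ring_scope.

Import HBNNSimple.

(** * Integrals of nonnegative functions without measurability *)

Section lower_integral.
Context (d : measure_display) (T : measurableType d) (R : realType).
Variable mu : {measure set T -> \bar R}.
Local Open Scope ereal_scope.

Lemma le_integral_nonmeas (f g : T -> \bar R) :
  (forall x, 0 <= f x) -> (forall x, f x <= g x) ->
  \int[mu]_x f x <= \int[mu]_x g x.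
Proof.
move=> f0 fg.
rewrite !ge0_integralTE//; last by move=> x; exact: le_trans (f0 x) (fg x).
apply: ge_ereal_sup => _ [s /= sf <-]; apply: ereal_sup_ubound.
by exists s => // x; exact: le_trans (sf x) (fg x).
Qed.

(** If [s] is a simple function below [f + g], then [max (s - g) 0] is measurable and lies below
    [f], while [s <= max (s - g) 0 + g]. Additivity is used only for this measurable pair. *)
Lemma integralD_le_nonmeas (f : T -> \bar R) (g : T -> R) :
  (forall x, 0 <= f x) -> (forall x, (0 <= g x)%R) -> measurable_fun setT g ->
  \int[mu]_x (f x + (g x)%:E) <= \int[mu]_x f x + \int[mu]_x (g x)%:E.
Proof.
move=> f0 g0 mg.
rewrite [leLHS]ge0_integralTE//; last first.
  by move=> x; rewrite adde_ge0// lee_fin.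
apply: ge_ereal_sup => _ [s /= sfg <-].
rewrite -(integralT_nnsfun mu).
have mr : measurable_fun setT (fun x => Num.max (s x - g x) 0)%R.
  by apply: measurable_maxr => //; apply: measurable_funB.
apply: (@le_trans _ _ (\int[mu]_x ((Num.max (s x - g x) 0)%R%:E + (g x)%:E))).
  apply: le_integral_nonmeas => x; first by rewrite lee_fin.
  by rewrite -EFinD lee_fin -lerBlDr le_max lexx.
rewrite ge0_integralD//; last 4 first.
- by move=> x _; rewrite lee_fin le_max lexx orbT.
- exact/measurable_EFinP.
- by move=> x _; rewrite lee_fin.
- exact/measurable_EFinP.
apply: leeD => //; apply: le_integral_nonmeas => x.
  by rewrite lee_fin le_max lexx orbT.
have [|_] := leP (s x - g x)%R 0%R; first by [].
by rewrite EFinB leeBlDr.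
Qed.

End lower_integral.

(** * Elementary bounds for the exponential and the logarithm *)

Section exp_bounds.
Variable R : realType.
Implicit Types u v : R.

Lemma expRB1_le u : `|expR u - 1| <= `|u| * expR `|u|.
Proof.
have [u0|u0] := leP 0 u.
- rewrite !ger0_norm//; last by rewrite subr_ge0 -expR0 ler_expR.
  have := expR_ge1Dx (- u); rewrite expRN => H.
  have e0 := expR_gt0 u.
  have := ler_wpM2r (ltW e0) H; rewrite mulVf ?gt_eqF//; lra.
- rewrite (ltr0_norm u0) ler0_norm; last first.
    by rewrite subr_le0 -expR0 ler_expR ltW.
  have := expR_ge1Dx u; have : 1 <= expR (- u) by rewrite -expR0 ler_expR; lra.
  nra.
Qed.

(** Mean value theorem between 0 and [u]. It lifts a bound on a Taylor remainder of [expR] to the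
    remainder of the next order. *)
Lemma norm_le_of_derive (f df : R -> R) (B : R -> R) u : f 0 = 0 ->
  (forall x : R, is_derive x (1 : R) f (df x)) ->
  (forall x, `|df x| <= B `|x|) -> (forall x y, 0 <= x -> x <= y -> B x <= B y) ->
  `|f u| <= `|u| * B `|u|.
Proof.
move=> f0 fdf dfB Bnd.
have cf : continuous f.
  by move=> x; apply/differentiable_continuous/derivable1_diffP; exact: ex_derive.
have [u0|u0|<-] := ltgtP 0 u; last by rewrite f0 normr0 mul0r.
- have [|c] := @MVT R f df 0 u u0 (fun x _ => fdf x).
    by apply: continuous_subspaceT.
  rewrite in_itv/= => /andP[c0 cu]; rewrite f0 !subr0 => ->.
  rewrite normrM mulrC ler_wpM2l// (le_trans (dfB _))// Bnd//.
  by rewrite !ger0_norm// ltW.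
- have [|c] := @MVT R f df u 0 u0 (fun x _ => fdf x).
    by apply: continuous_subspaceT.
  rewrite in_itv/= => /andP[c0 cu]; rewrite f0 !sub0r => /eqP.
  rewrite eqr_oppLR => /eqP ->.
  rewrite normrN normrM normrN mulrC ler_wpM2l// (le_trans (dfB _))// Bnd//.
  by rewrite !ltr0_norm//; lra.
Qed.

Lemma expR_taylor1 u : `|expR u - 1 - u| <= `|u| ^+ 2 * expR `|u|.
Proof.
have := @norm_le_of_derive (fun u => expR u - 1 - u) (fun u => expR u - 1)
  (fun x => x * expR x) u.
rewrite expr2 -mulrA; apply.
- by rewrite expR0; lra.
- by move=> x; apply: is_derive_eq; rewrite /=; lra.
- exact: expRB1_le.
- by move=> x y x0 xy; rewrite ler_pM ?expR_ge0 ?ler_expR.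
Qed.

Lemma expR_taylor2 u :
  `|expR u - 1 - u - u ^+ 2 / 2| <= `|u| ^+ 3 * expR `|u|.
Proof.
have := @norm_le_of_derive (fun u => expR u - 1 - u - u ^+ 2 / 2)
  (fun u => expR u - 1 - u) (fun x => x ^+ 2 * expR x) u.
rewrite (exprS `|u| 2) -mulrA; apply.
- by rewrite expR0; lra.
- move=> x; apply: is_derive_eq; rewrite /= /GRing.scale/=; lra.
- exact: expR_taylor1.
- move=> x y x0 xy; rewrite ler_pM ?expR_ge0 ?ler_expR ?exprn_ge0//.
  by rewrite lerXn2r ?nnegrE// (le_trans x0).
Qed.

(** Both sides come from [ln (1 + x) <= x], applied to [u] and, since
    [1 / (1 + u) = 1 - u / (1 + u)], to [- u / (1 + u)]. *)
Lemma ln_taylor1 u : `|u| <= 1/2 -> `|ln (1 + u) - u| <= 2 * u ^+ 2.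
Proof.
move=> u1; have [u1a u1b] : -1/2 <= u /\ u <= 1/2 by move: u1; rewrite ler_norml; lra.
have h1 : ln (1 + u) <= u by apply: le_ln1Dx; lra.
have h2 : - ln (1 + u) <= - (u / (1 + u)).
  rewrite -lnV ?posrE; last lra.
  have e : (1 + u)^-1 = 1 + (- (u / (1 + u))) by field; lra.
  rewrite [X in ln X]e.
  apply: le_ln1Dx; rewrite ltrNr opprK ltr_pdivrMr; lra.
have h3 : u - 2 * u ^+ 2 <= u / (1 + u) by rewrite ler_pdivlMr; nra.
rewrite ler_norml; apply/andP; split; last nra.
lra.
Qed.

Lemma expR_convex (t w : R) : 0 <= t <= 1 ->
  expR (t * w) <= t * expR w + (1 - t).
Proof.
move=> /andP[t0 t1].
(* [e^w] and [e^0] lie above the tangent of [expR] at [t * w] *)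
have a := expR_ge1Dx (w - t * w); have b := expR_ge1Dx (- (t * w)).
have e0 := expR_gt0 (t * w).
have ea : expR w = expR (t * w) * expR (w - t * w) by rewrite -expRD; congr expR; ring.
have eb : 1 = expR (t * w) * expR (- (t * w)) by rewrite -expRD addrN expR0.
rewrite [X in _ + (X - _)]eb ea.
set E := expR (t * w) in e0 *; set A := expR _ in a *; set B := expR _ in b *.
have : t * (1 + (w - t * w)) + (1 - t) * (1 - t * w) <= t * A + (1 - t) * B.
  by apply: lerD; apply: ler_wpM2l => //; lra.
move=> H; have : E * 1 <= E * (t * A + (1 - t) * B).
  by apply: ler_wpM2l; [exact: ltW|apply: le_trans H; nra].
by have := eb; rewrite -/E -/B => {}eb; nra.
Qed.

(** A quadratic remainder makes the difference quotient converge. Both derivatives of [b] are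
    obtained this way, without differentiating under the integral sign. *)
Lemma derive1_of_quadratic_bound (f : R -> R) (a D C r : R) : 0 < r ->
  (forall x, `|x| <= r -> `|f (a + x) - f a - D * x| <= C * x ^+ 2) ->
  is_derive a (1 : R) f D.
Proof.
move=> r0 H.
suff cv : h^-1 *: ((f \o shift a) (h *: 1) - f a) @[h --> 0^'] --> D.
  by apply: DeriveDef; [apply/cvg_ex; exists D | apply/cvg_lim].
apply/cvgrPdist_le => e e0.
(* The bound at [x = r] forces the sign of [C]. *)
have C0 : 0 <= C.
  have := H r; rewrite (gtr0_norm r0) => /(_ (lexx _)) h.
  have := le_trans (normr_ge0 _) h; rewrite pmulr_lge0 ?exprn_gt0//.
near=> x.
have x0 : x != 0 by near: x; exact: nbhs_dnbhs_neq.
have xr : `|x| <= r.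
  by near: x; apply: dnbhs0_le.
have xe : `|x| <= e / (C + 1).
  by near: x; apply: dnbhs0_le; rewrite divr_gt0//; lra.
have -> : D - x^-1 *: ((f \o shift a) (x *: 1) - f a) =
   - (x^-1 * (f (a + x) - f a - D * x)).
  rewrite /GRing.scale/= mulr1 (addrC x); field; exact: x0.
rewrite normrN normrM normfV ler_pdivrMl ?normr_gt0//.
rewrite (le_trans (H _ xr))// -real_normK ?num_real// expr2 mulrCA.
rewrite ler_wpM2l//; move: xe; rewrite ler_pdivlMr; last lra.
have := normr_ge0 x; nra.
Unshelve. all: by end_near. Qed.

End exp_bounds.

(** * Partition function and densities of the exponential family *)

Section exponential_family.
Variables (R : realType) (nu : {measure set R -> \bar R}) (h : R -> R).
Hypotheses (h0 : forall y, 0 <= h y) (mh : measurable_fun setT h).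
Implicit Types (eta x t lam y c r : R).
Local Notation b := (logpart nu h).
Local Notation Z eta := (\int[nu]_y (expR (eta * y) * h y)%:E)%E.

Lemma measurable_expRM (eta : R) :
  measurable_fun setT (fun y : R => expR (eta * y)).
Proof. by apply: measurableT_comp => //; exact: measurable_funM. Qed.

Lemma measurable_efdens eta : measurable_fun setT (efdens nu h eta).
Proof.
apply: measurable_funM => //; apply: measurableT_comp => //.
by apply: measurable_funB => //; exact: measurable_funM.
Qed.

Lemma efdens_ge0 eta y : 0 <= efdens nu h eta y.
Proof. by rewrite mulr_ge0 ?expR_ge0. Qed.

Lemma efdensD eta x y : efdens nu h (eta + x) y =
  expR (x * y - (b (eta + x) - b eta)) * efdens nu h eta y.
Proof.
rewrite /efdens mulrA -expRD; move: (b _) (b _) => u v.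
by congr (expR _ * _); ring.
Qed.

(** The exponential factor never vanishes, so either equation says that [h = 0] almost everywhere
    for [nu]. *)
Lemma partition_eq0 eta eta' : Z eta = 0%E -> Z eta' = 0%E.
Proof.
have m e : measurable_fun setT (fun y : R => (expR (e * y) * h y)%:E).
  by apply/measurable_EFinP/measurable_funM => //; exact: measurable_expRM.
have nn e y : `|(expR (e * y) * h y)%:E|%E = (expR (e * y) * h y)%:E.
  by rewrite gee0_abs// lee_fin mulr_ge0 ?expR_ge0.
have E e : (\int[nu]_y `|(expR (e * y) * h y)%:E| = Z e)%E.
  by apply: eq_integral => y _; rewrite nn.
rewrite -!E => /(ae_eq_integral_abs nu measurableT (m eta)) H.
apply/(ae_eq_integral_abs nu measurableT (m eta')).
apply: filterS H => y /= H _; have [/eqP] := H I.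
by rewrite mulf_eq0 gt_eqF ?expR_gt0//= => /eqP ->; rewrite mulr0.
Qed.

(** If the partition function vanished at one point it would vanish everywhere; as [ln 0 = 0] by
    convention, [b] would be constant and its second derivative zero. *)
Lemma partition_gt0 eta : derive1 (derive1 b) eta != 0 ->
  forall eta', (0 < Z eta')%E.
Proof.
move=> H eta'; rewrite lt0e; apply/andP; split; last first.
  by apply: integral_ge0 => y _; rewrite lee_fin mulr_ge0 ?expR_ge0.
apply: contra H => /eqP Z0.
have -> : b = cst 0.
  apply/funext => x; rewrite /logpart (_ : Z x = 0%E) /= ?ln0//.
  exact: partition_eq0 Z0.
by rewrite (_ : derive1 (cst 0) = cst 0) ?derive1_cst//; apply/funext => x; rewrite derive1_cst.
Qed.

Hypothesis Zgt0 : forall eta, (0 < Z eta)%E.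

Lemma expR_logpart eta : natparam nu h eta -> ((expR (b eta))%:E = Z eta)%E.
Proof.
move=> Ne; have f : Z eta \is a fin_num by rewrite ge0_fin_numE// ltW.
by rewrite /logpart lnK ?fineK// posrE fine_gt0// Zgt0.
Qed.

Lemma integral_efdens eta : natparam nu h eta ->
  (\int[nu]_y (efdens nu h eta y)%:E = 1)%E.
Proof.
move=> Ne.
under eq_integral do rewrite /efdens addrC expRD -mulrA EFinM.
rewrite ge0_integralZl_EFin ?expR_ge0//.
- by rewrite -expR_logpart// -EFinM -expRD addNr expR0.
- by move=> y _; rewrite lee_fin mulr_ge0 ?expR_ge0.
- by apply/measurable_EFinP/measurable_funM => //; exact: measurable_expRM.
Qed.


End exponential_family.

(** * Convexity and Taylor expansion of the log-partition function *)

(* The exponential family enters only through the tilting identity [fD], so the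
   densities [f] and the log-partition function [b] are kept abstract. *)
Section tilted_family.
Variables (R : realType) (nu : {measure set R -> \bar R}) (N : set R).
Variables (b : R -> R) (f : R -> R -> R).
Implicit Types (eta x t lam y c r : R).
Hypothesis f0 : forall eta y, 0 <= f eta y.
Hypothesis mf : forall eta, measurable_fun setT (f eta).
Hypothesis f1 : forall eta, N eta -> (\int[nu]_y (f eta y)%:E = 1)%E.
Hypothesis fD : forall eta x y,
  f (eta + x) y = expR (x * y - (b (eta + x) - b eta)) * f eta y.

Lemma integral_scale_density (k : R) eta : 0 <= k -> N eta ->
  (\int[nu]_y (k * f eta y)%:E = k%:E)%E.
Proof.
move=> k0 Ne; under eq_integral do rewrite EFinM.
rewrite ge0_integralZl_EFin//.
- by rewrite f1// mule1.
- by move=> y _; rewrite lee_fin f0.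
- exact/measurable_EFinP.
Qed.

(* Hoelder's inequality for the partition function, via
   [e^(t w) <= t e^w + (1 - t)] at [w = x y - (b (eta + x) - b eta)]. *)
Lemma logpart_convex eta x t : N eta -> N (eta + x) -> N (eta + t * x) ->
  0 <= t <= 1 -> b (eta + t * x) - b eta <= t * (b (eta + x) - b eta).
Proof.
move=> Ne Nex Netx t01; have /andP[t0 t1] := t01.
pose D := b (eta + x) - b eta; pose D' := b (eta + t * x) - b eta.
have H : (\int[nu]_y (expR (D' - t * D) * f (eta + t * x) y)%:E <=
     \int[nu]_y ((t * f (eta + x) y)%:E + ((1 - t) * f eta y)%:E))%E.
  apply: ge0_le_integral => //.
  - by move=> y _; rewrite lee_fin mulr_ge0 ?expR_ge0.
  - by apply/measurable_EFinP; apply: measurable_funM.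
  - by apply: emeasurable_funD; apply/measurable_EFinP; apply: measurable_funM.
  - move=> y _; rewrite -EFinD lee_fin !fD !mulrA -expRD -mulrDl.
    rewrite ler_wpM2r//.
    have -> : D' - t * D + (t * x * y - (b (eta + t * x) - b eta)) =
       t * (x * y - D) by rewrite /D'; ring.
    exact: expR_convex.
move: H; rewrite integral_scale_density ?expR_ge0// ge0_integralD//; last 4 first.
- by move=> y _; rewrite lee_fin mulr_ge0.
- by apply/measurable_EFinP; apply: measurable_funM.
- by move=> y _; rewrite lee_fin mulr_ge0 ?subr_ge0.
- by apply/measurable_EFinP; apply: measurable_funM.
rewrite !integral_scale_density ?subr_ge0// -EFinD lee_fin subrKC.
by rewrite -[leRHS]expR0 ler_expR subr_le0.
Qed.

(** * Moment generating function of the reward centered at [c] *)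

Section local_expansion.
Variables (eta r c : R).
Hypotheses (r0 : 0 < r) (Nr : forall x, `|x| <= r -> N (eta + x)).
Local Notation w := (f eta).
Local Notation z y := (y - c).
Local Notation dom y := (expR (r * z y) + expR (- r * z y)).
Local Notation E f := (\int[nu]_y ((f : R -> R) y * w y)).

Let Neta : N eta.
Proof. by rewrite -[eta]addr0; apply: Nr; rewrite normr0 ltW. Qed.

Let measurable_z : measurable_fun setT (fun y : R => z y).
Proof. exact: measurable_funB. Qed.

Lemma exp_tilt lam y : expR (lam * z y) * w y =
  expR (b (eta + lam) - b eta - lam * c) * f (eta + lam) y.
Proof. by rewrite fD mulrA -expRD; congr (expR _ * _); ring. Qed.

Lemma integrable_density x : `|x| <= r ->
  nu.-integrable setT (EFin \o f (eta + x)).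
Proof.
move=> xr; apply/integrableP; split.
  exact/measurable_EFinP.
under eq_integral do rewrite /= ger0_norm //.
by rewrite f1 ?ltry//; exact: Nr.
Qed.

Lemma integrable_exp_tilt lam : `|lam| <= r ->
  nu.-integrable setT (EFin \o (fun y => expR (lam * z y) * w y)).
Proof.
move=> xr.
have -> : EFin \o (fun y => expR (lam * z y) * w y) = fun y =>
   ((expR (b (eta + lam) - b eta - lam * c))%:E *
    (EFin \o f (eta + lam)) y)%E.
  by apply/funext => y /=; rewrite exp_tilt EFinM.
by apply: integrableZl => //; exact: integrable_density.
Qed.

(** Each summand is a multiple of the density at [eta + r] or [eta - r]. Since [dom] is at least
    [e^(r |z|)], it serves as the dominating function for all moments below. *)
Lemma integrable_dom :
  nu.-integrable setT (EFin \o (fun y => dom y * w y)).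
Proof.
have -> : EFin \o (fun y => dom y * w y) =
   (EFin \o (fun y => expR (r * z y) * w y)) \+
   (EFin \o (fun y => expR (- r * z y) * w y)).
  by apply/funext => y /=; rewrite mulrDl EFinD.
by apply: integrableD => //; apply: integrable_exp_tilt;
  rewrite ?normrN gtr0_norm.
Qed.

Lemma integrable_of_dom (g : R -> R) K : measurable_fun setT g ->
  (forall y, `|g y| <= K * dom y) ->
  nu.-integrable setT (EFin \o (fun y => g y * w y)).
Proof.
move=> mg gK.
apply: (le_integrable measurableT _ _ (integrableZl measurableT K integrable_dom)).
- by apply/measurable_EFinP/measurable_funM => //; exact: mf.
- move=> y _; rewrite /= lee_fin normrM mulrA normrM.
  by rewrite ler_wpM2r// (le_trans (gK y))// ler_norm.
Qed.

Lemma Rintegral_le_dom (g : R -> R) K : measurable_fun setT g ->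
  (forall y, `|g y| <= K * dom y) ->
  `|E g| <= K * E (fun y => dom y).
Proof.
move=> mg gK; have ig := integrable_of_dom mg gK.
apply: le_trans (le_normr_Rintegral measurableT ig) _.
rewrite -RintegralZl//; last exact: integrable_dom.
apply: le_Rintegral => //.
- by have := integrable_abse ig.
- have := integrableZl measurableT K integrable_dom.
  by congr integrable; apply/funext => y /=; rewrite EFinM.
- move=> y _; rewrite normrM mulrA (ger0_norm (f0 _ _)).
  by rewrite ler_wpM2r ?f0.
Qed.

Lemma expR_norm_le_dom y : expR (r * `|z y|) <= dom y.
Proof.
have e1 := expR_ge0 (r * z y); have e2 := expR_ge0 (- r * z y).
have [y0|y0] := leP 0 (z y).
  by rewrite ger0_norm// lerDl.
by rewrite ltr0_norm// mulrN -mulNr lerDr.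
Qed.

(** The exponent [r |z|] is split in halves: one absorbs the cube through [x^3 <= 6 e^x] at
    [x = r |z| / 2], the other covers [e^|lam z|]. *)
Lemma cubic_exp_le_dom lam y : `|lam| <= r / 2 ->
  `|z y| ^+ 3 * expR `|lam * z y| <= 6 * (2 / r) ^+ 3 * dom y.
Proof.
move=> lr; set a := `|z y|; have a0 : 0 <= a by exact: normr_ge0.
have ra : 0 <= r / 2 * a by rewrite mulr_ge0// divr_ge0// ltW.
have := @expR_ge1Dxn R (r / 2 * a) 2 ra.
rewrite (_ : 3`!%:R = 6) // => h1.
have h2 : expR `|lam * z y| <= expR (r / 2 * a).
  by rewrite ler_expR normrM ler_wpM2r.
have h3 : a ^+ 3 <= 6 * (2 / r) ^+ 3 * expR (r / 2 * a).
  have h4 : (r / 2 * a) ^+ 3 <= 6 * expR (r / 2 * a) by lra.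
  have -> : a ^+ 3 = (2 / r) ^+ 3 * (r / 2 * a) ^+ 3 by field; rewrite gt_eqF.
  rewrite (mulrC 6) -[leRHS]mulrA ler_wpM2l//.
  by rewrite exprn_ge0// divr_ge0// ltW.
apply: le_trans (ler_pM _ (expR_ge0 _) h3 h2) _; first by rewrite exprn_ge0.
rewrite -[leLHS]mulrA -expRD -mulrDl -splitr.
rewrite ler_wpM2l//; last exact: expR_norm_le_dom.
by rewrite mulr_ge0// exprn_ge0// divr_ge0// ltW.
Qed.

Lemma pow_le_dom k y :
  `|z y ^+ k.+1| <= k.+1`!%:R * r^-1 ^+ k.+1 * dom y.
Proof.
set a := `|z y|; have a0 : 0 <= a by exact: normr_ge0.
have ra : 0 <= r * a by rewrite mulr_ge0// ltW.
have := @expR_ge1Dxn R (r * a) k ra => h1.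
have h2 := expR_norm_le_dom y.
have kf0 : 0 < k.+1`!%:R :> R by rewrite ltr0n fact_gt0.
have h3 : (r * a) ^+ k.+1 <= k.+1`!%:R * dom y.
  rewrite -ler_pdivrMl// mulrC; apply: le_trans h2; apply: le_trans h1.
  by rewrite lerDr.
rewrite normrX -/a.
have -> : a ^+ k.+1 = r^-1 ^+ k.+1 * (r * a) ^+ k.+1.
  by rewrite -exprMn mulKf// gt_eqF.
by rewrite -mulrA mulrCA ler_wpM2l// exprn_ge0// invr_ge0 ltW.
Qed.

Lemma Rintegral_density : E (fun=> 1) = 1.
Proof.
rewrite /Rintegral; under eq_integral do rewrite mul1r.
by rewrite f1.
Qed.

Lemma integrable_one : nu.-integrable setT (EFin \o (fun y => 1 * w y)).
Proof.
apply: (@integrable_of_dom (fun=> 1) 1) => // y.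
rewrite normr1 mul1r (le_trans _ (expR_norm_le_dom y))// -expR0 ler_expR.
by rewrite mulr_ge0// ltW.
Qed.

Lemma integrable_pow k :
  nu.-integrable setT (EFin \o (fun y => z y ^+ k.+1 * w y)).
Proof.
apply: (@integrable_of_dom (fun y => z y ^+ k.+1)
  (k.+1`!%:R * r^-1 ^+ k.+1)); last exact: pow_le_dom.
exact: measurable_funX.
Qed.

Lemma measurable_exp_z lam : measurable_fun setT (fun y : R => expR (lam * z y)).
Proof. by apply: measurableT_comp => //; exact: measurable_funM. Qed.

Lemma integrable_z_exp lam : `|lam| <= r / 2 ->
  nu.-integrable setT (EFin \o (fun y => (z y * expR (lam * z y)) * w y)).
Proof.
move=> lr; apply: (@integrable_of_dom (fun y => z y * expR (lam * z y))
  (r^-1 *+ 2)).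
  by apply: measurable_funM => //; exact: measurable_exp_z.
move=> y; set a := `|z y|; have a0 : 0 <= a by exact: normr_ge0.
have h1 := expR_ge1Dx (r / 2 * a).
have h2 : expR (lam * z y) <= expR (r / 2 * a).
  by rewrite ler_expR (le_trans (ler_norm _))// normrM ler_wpM2r.
have h3 : a <= r^-1 *+ 2 * expR (r / 2 * a).
  have e : a = (r^-1 *+ 2) * (r / 2 * a) by rewrite mulr2n; field; rewrite gt_eqF.
  rewrite {1}e ler_wpM2l//; last lra.
  by rewrite mulrn_wge0// invr_ge0 ltW.
rewrite normrM (ger0_norm (expR_ge0 _)).
apply: le_trans (ler_pM a0 (expR_ge0 _) h3 h2) _.
rewrite -[leLHS]mulrA -expRD -mulrDl -splitr.
rewrite ler_wpM2l//; last exact: expR_norm_le_dom.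
by rewrite mulrn_wge0// invr_ge0 ltW.
Qed.

(** The pointwise bound [expR_taylor2] at [lam * z] is integrated against the density;
    [cubic_exp_le_dom] makes the remainder integrable. *)
Lemma mgf_expansion lam : `|lam| <= r / 2 ->
  `|E (fun y => expR (lam * z y)) - 1 - lam * E (fun y => z y)
    - lam ^+ 2 / 2 * E (fun y => z y ^+ 2)| <=
  `|lam| ^+ 3 * (6 * (2 / r) ^+ 3 * E (fun y => dom y)).
Proof.
move=> lr; have lr' : `|lam| <= r by rewrite (le_trans lr)// ler_pdivrMr// ler_peMr ?ltW// ltr1n.
have i1 := integrable_one; have iz := integrable_pow 0; have iz2 := integrable_pow 1.
have ie := integrable_exp_tilt lr'.
have mg : measurable_fun setT (fun y =>
    expR (lam * z y) - 1 - lam * z y - lam ^+ 2 / 2 * z y ^+ 2).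
  apply: measurable_funB; last by apply: measurable_funM => //; exact: measurable_funX.
  apply: measurable_funB; last exact: measurable_funM.
  by apply: measurable_funB => //; exact: measurable_exp_z.
have gK y : `|expR (lam * z y) - 1 - lam * z y - lam ^+ 2 / 2 * z y ^+ 2| <=
    `|lam| ^+ 3 * (6 * (2 / r) ^+ 3) * dom y.
  have := expR_taylor2 (lam * z y).
  rewrite exprMn (_ : lam ^+ 2 * z y ^+ 2 / 2 = lam ^+ 2 / 2 * z y ^+ 2); last by ring.
  move=> /le_trans; apply.
  rewrite [X in X ^+ 3]normrM exprMn -[leLHS]mulrA -[leRHS]mulrA.
  by rewrite ler_wpM2l ?exprn_ge0// cubic_exp_le_dom.
have := Rintegral_le_dom mg gK; rewrite -[leRHS]mulrA; apply: le_trans.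
rewrite le_eqVlt; apply/orP; left; apply/eqP; congr (`|_|).
have e1 : \int[nu]_y (lam * (z y ^+ 1 * w y)) = lam * E (fun y => z y).
  by rewrite RintegralZl.
have e2 : \int[nu]_y (lam ^+ 2 / 2 * (z y ^+ 2 * w y)) =
    lam ^+ 2 / 2 * E (fun y => z y ^+ 2).
  by rewrite RintegralZl.
have j1 : nu.-integrable setT (EFin \o (fun y => lam * (z y ^+ 1 * w y))).
  exact: (integrableZl measurableT lam iz).
have j2 : nu.-integrable setT
    (EFin \o (fun y => lam ^+ 2 / 2 * (z y ^+ 2 * w y))).
  exact: (integrableZl measurableT (lam ^+ 2 / 2) iz2).
rewrite -{1}Rintegral_density -e1 -e2 -RintegralB// -RintegralB//; last first.
  exact: (integrableB measurableT ie i1).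
rewrite -RintegralB//; last first.
  exact: (integrableB measurableT (integrableB measurableT ie i1) j1).
by apply: eq_Rintegral => y _; ring.
Qed.

(** Same argument for the derivative in [lam]: [expR_taylor1] multiplied by [z] again leaves a cubic
    remainder in [z]. *)
Lemma mgf_deriv_expansion lam : `|lam| <= r / 2 ->
  `|E (fun y => z y * expR (lam * z y)) - E (fun y => z y)
    - lam * E (fun y => z y ^+ 2)| <=
  `|lam| ^+ 2 * (6 * (2 / r) ^+ 3 * E (fun y => dom y)).
Proof.
move=> lr.
have iz := integrable_pow 0; have iz2 := integrable_pow 1.
have ie := integrable_z_exp lr.
have mg : measurable_fun setT (fun y =>
    z y * expR (lam * z y) - z y - lam * z y ^+ 2).
  apply: measurable_funB; last by apply: measurable_funM => //; exact: measurable_funX.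
  apply: measurable_funB => //.
  by apply: measurable_funM => //; exact: measurable_exp_z.
have gK y : `|z y * expR (lam * z y) - z y - lam * z y ^+ 2| <=
    `|lam| ^+ 2 * (6 * (2 / r) ^+ 3) * dom y.
  have := expR_taylor1 (lam * z y).
  have -> : z y * expR (lam * z y) - z y - lam * z y ^+ 2 =
     z y * (expR (lam * z y) - 1 - lam * z y) by ring.
  move=> H; rewrite [leLHS]normrM.
  apply: le_trans (ler_wpM2l (normr_ge0 _) H) _.
  rewrite [X in X ^+ 2 * expR _]normrM exprMn.
  have -> : `|z y| * (`|lam| ^+ 2 * `|z y| ^+ 2 * expR `|lam * z y|) =
    `|lam| ^+ 2 * (`|z y| ^+ 3 * expR `|lam * z y|) by ring.
  rewrite -mulrA ler_wpM2l ?exprn_ge0//.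
  exact: cubic_exp_le_dom.
have := Rintegral_le_dom mg gK; rewrite -[leRHS]mulrA; apply: le_trans.
rewrite le_eqVlt; apply/orP; left; apply/eqP; congr (`|_|).
have e2 : \int[nu]_y (lam * (z y ^+ 2 * w y)) =
    lam * E (fun y => z y ^+ 2).
  by rewrite RintegralZl.
have j2 : nu.-integrable setT (EFin \o (fun y => lam * (z y ^+ 2 * w y))).
  exact: (integrableZl measurableT lam iz2).
have e1 : E (fun y => z y) = \int[nu]_y (z y ^+ 1 * w y) by [].
rewrite e1 -e2 -RintegralB// -RintegralB//; last first.
  exact: (integrableB measurableT ie iz).
by apply: eq_Rintegral => y _; ring.
Qed.

Lemma mgfE lam : `|lam| <= r ->
  E (fun y => expR (lam * z y)) = expR (b (eta + lam) - b eta - lam * c).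
Proof.
move=> lr; under eq_Rintegral do rewrite exp_tilt.
rewrite RintegralZl//; last exact: integrable_density.
by rewrite /Rintegral f1 ?mulr1//; exact: Nr.
Qed.

(** Tilting turns the derivative of the generating function into a mean under the density at
    [eta + lam], which gives access to [mean] at nearby parameters. *)
Lemma mgf_derivE lam : `|lam| <= r / 2 ->
  E (fun y => z y * expR (lam * z y)) = expR (b (eta + lam) - b eta - lam * c) *
    \int[nu]_y (z y * f (eta + lam) y).
Proof.
move=> lr.
have H y : z y * f (eta + lam) y =
    expR (- (b (eta + lam) - b eta - lam * c)) * (z y * expR (lam * z y) * w y).
  rewrite fD (_ : lam * y - _ = - (b (eta + lam) - b eta - lam * c) + lam * z y).
    by rewrite expRD; ring.
  by ring.
under [X in _ = _ * X]eq_Rintegral do rewrite H.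
rewrite RintegralZl//; last exact: integrable_z_exp.
by rewrite mulrA -expRD subrr expR0 mul1r.
Qed.

End local_expansion.

(** * Mean and variance as first and second derivatives of [b] *)

Definition mean eta : R := \int[nu]_y (y * f eta y).
Definition variance eta : R := \int[nu]_y ((y - mean eta) ^+ 2 * f eta y).

Lemma variance_ge0 eta : 0 <= variance eta.
Proof. by apply: Rintegral_ge0 => y _; rewrite mulr_ge0// sqr_ge0. Qed.

Lemma interior_radius eta : N° eta ->
  exists2 r, 0 < r & forall x, `|x| <= r -> N° (eta + x).
Proof.
move=> /nbhs_interior/nbhs_ballP[e /= e0 H]; exists (e / 2); first by rewrite divr_gt0.
move=> x xe; apply: H; rewrite /ball/= opprD addNKr normrN.
by rewrite (le_lt_trans xe)// ltr_pdivrMr// ltr_pMr// ltr1n.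
Qed.

Lemma integrable_mean eta r : 0 < r ->
  (forall x, `|x| <= r -> N (eta + x)) ->
  nu.-integrable setT (EFin \o (fun y => y * f eta y)).
Proof.
move=> r0 Nr; have := @integrable_pow eta r 0 r0 Nr 0.
by congr integrable; apply/funext => y /=; rewrite subr0.
Qed.

Lemma integral_center eta c r : 0 < r ->
  (forall x, `|x| <= r -> N (eta + x)) ->
  \int[nu]_y ((y - c) * f eta y) = mean eta - c.
Proof.
move=> r0 Nr; have := @integrable_one eta r c r0 Nr => i1.
have i2 := integrable_mean r0 Nr.
have := @Rintegral_density eta r r0 Nr => E1.
rewrite -[X in _ - X]mulr1 -E1 -RintegralZl// -RintegralB//.
- by apply: eq_Rintegral => y _; ring.
- exact: (integrableZl measurableT c i1).
Qed.

(* [u] is the centered moment generating function minus one and [m1] is its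
   derivative. *)
Lemma centered_mgf eta r : 0 < r -> (forall x, `|x| <= r -> N (eta + x)) ->
  exists K r1 : R, [/\ 0 <= K, 0 < r1 & forall lam, `|lam| <= r1 ->
    let u := expR (b (eta + lam) - b eta - lam * mean eta) - 1 in
    let m1 := (1 + u) * (mean (eta + lam) - mean eta) in
    [/\ `|u - lam ^+ 2 / 2 * variance eta| <= K * `|lam| ^+ 3,
        `|m1 - lam * variance eta| <= K * `|lam| ^+ 2,
        `|u| <= (variance eta + K) * `|lam| ^+ 2 &
        `|u| <= 1 / 2]].
Proof.
move=> r0 Nr; pose c := mean eta.
pose K := 6 * (2 / r) ^+ 3 *
  \int[nu]_y ((expR (r * (y - c)) + expR (- r * (y - c))) * f eta y).
have K0 : 0 <= K.
  rewrite mulr_ge0//; first by rewrite mulr_ge0// exprn_ge0// divr_ge0// ltW.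
  by apply: Rintegral_ge0 => y _; rewrite mulr_ge0// addr_ge0// expR_ge0.
have v0 := variance_ge0 eta.
have B0 : 0 < 2 * (variance eta + K) + 1 by lra.
(* The second radius yields [|lam| <= 1] and [(variance eta + K) |lam| <= 1/2], hence [|u| <= 1/2],
   so that [ln (1 + u)] and division by [1 + u] are under control. *)
exists K, (Num.min (r / 2) (2 * (variance eta + K) + 1)^-1); split => //.
  by rewrite lt_min divr_gt0//= invr_gt0.
move=> lam; rewrite le_min => /andP[lr lB].
have lr' : `|lam| <= r by rewrite (le_trans lr)// ler_pdivrMr// ler_peMr ?ltW// ltr1n.
have := @mgf_expansion eta r c r0 Nr lam lr.
have := @mgf_deriv_expansion eta r c r0 Nr lam lr.
rewrite (@mgfE eta r c Nr lam lr') (@mgf_derivE eta r c r0 Nr lam lr).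
have Nr2 x : `|x| <= r / 2 -> N (eta + lam + x).
  move=> xr; rewrite -addrA; apply: Nr.
  by rewrite (le_trans (ler_normD _ _))// [leRHS]splitr lerD.
have r20 : 0 < r / 2 by rewrite divr_gt0.
rewrite (integral_center c r0 Nr) (integral_center c r20 Nr2).
rewrite -/K subrr mulr0 !subr0 -[\int[nu]_y _]/(variance eta).
set e := expR _; set v := variance eta in v0 B0 lB *; set d := mean (eta + lam) - c.
move=> h1 h2.
have eE : 1 + (e - 1) = e by rewrite addrCA subrr addr0.
have l1 : `|lam| * (2 * (v + K) + 1) <= 1.
  by move: lB; rewrite -ler_pdivlMr// div1r.
have l0 := normr_ge0 lam.
have vK0 : 0 <= (v + K) * `|lam| by rewrite mulr_ge0// addr_ge0.
have l1' : `|lam| <= 1 by lra.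
have u1 : `|e - 1| <= (v + K) * `|lam| ^+ 2.
  have -> : e - 1 = (e - 1 - lam ^+ 2 / 2 * v) + lam ^+ 2 / 2 * v by ring.
  apply: le_trans (ler_normD _ _) _.
  have n2 : `|lam ^+ 2 / 2 * v| = `|lam| ^+ 2 / 2 * v.
    by rewrite real_normK ?num_real// ger0_norm// mulr_ge0// divr_ge0// sqr_ge0.
  rewrite n2; apply: le_trans (lerD h2 (lexx _)) _.
  have p2 : 0 <= `|lam| ^+ 2 by rewrite exprn_ge0.
  have p3 : `|lam| ^+ 3 <= `|lam| ^+ 2.
    by rewrite exprS ler_piMl.
  have := ler_wpM2r K0 p3; have := mulr_ge0 v0 p2; lra.
cbv zeta; rewrite eE; split => //.
- by rewrite [leRHS]mulrC.
- by rewrite [leRHS]mulrC.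
apply: le_trans u1 _.
rewrite expr2 mulrA; apply: (@le_trans _ _ ((v + K) * `|lam| * 1)).
  by rewrite ler_wpM2l.
lra.
Qed.

(** The centered log-partition increment is [ln (1 + u)]. Replacing it by [u] costs [2 u^2], of
    order [x^4], and [u] itself is quadratic up to a cubic error. *)
Lemma logpart_taylor_moments eta : N° eta ->
  exists C r : R, [/\ 0 <= C, 0 < r & forall x, `|x| <= r ->
    `|b (eta + x) - b eta - mean eta * x - variance eta / 2 * x ^+ 2| <=
      C * `|x| ^+ 3].
Proof.
move=> /interior_radius[r r0 Nr].
have {}Nr x : `|x| <= r -> N (eta + x) by move=> /Nr/interior_subset.
have [K [r1 [K0 r10 H]]] := centered_mgf r0 Nr.
set v := variance eta in H *.
have v0 : 0 <= v := variance_ge0 eta.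
exists (K + 2 * (v + K) ^+ 2), (Num.min r1 1); split => //.
- by rewrite addr_ge0// mulr_ge0// sqr_ge0.
- by rewrite lt_min r10 ltr01.
move=> x; rewrite le_min => /andP[xr x1].
have [] := H x xr; set u := expR _ - 1 => h1 _ h2 h3.
have := ln_taylor1 h3.
have -> : ln (1 + u) = b (eta + x) - b eta - x * mean eta.
  by rewrite /u addrCA subrr addr0 expRK.
set l := b (eta + x) - b eta - x * mean eta => h4.
have -> : b (eta + x) - b eta - mean eta * x - v / 2 * x ^+ 2 =
  (l - u) + (u - x ^+ 2 / 2 * v) by rewrite /l; ring.
apply: le_trans (ler_normD _ _) _; rewrite mulrDl addrC lerD//.
apply: le_trans h4 _; rewrite -mulrA ler_wpM2l//.
rewrite -real_normK ?num_real//.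
apply: (@le_trans _ _ (((v + K) * `|x| ^+ 2) ^+ 2)).
  by rewrite lerXn2r ?nnegrE// mulr_ge0 ?exprn_ge0// addr_ge0.
rewrite exprMn ler_wpM2l ?sqr_ge0// -exprM.
by rewrite (_ : (2 * 2 = 1 + 3)%N)// exprS ler_piMl ?exprn_ge0.
Qed.

Lemma is_derive_logpart eta : N° eta -> is_derive eta (1 : R) b (mean eta).
Proof.
move=> /logpart_taylor_moments[C [r [C0 r0 H]]].
apply: (@derive1_of_quadratic_bound _ b eta (mean eta)
  (C + variance eta / 2) (Num.min r 1)); first by rewrite lt_min r0 ltr01.
move=> x; rewrite le_min => /andP[xr x1].
have v0 := variance_ge0 eta.
have -> : b (eta + x) - b eta - mean eta * x =
  (b (eta + x) - b eta - mean eta * x - variance eta / 2 * x ^+ 2) +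
  variance eta / 2 * x ^+ 2 by ring.
apply: le_trans (ler_normD _ _) _; rewrite mulrDl lerD//.
- apply: le_trans (H x xr) _; rewrite ler_wpM2l// -[leRHS]real_normK ?num_real//.
  by rewrite exprS ler_piMl// exprn_ge0.
- by rewrite ger0_norm// mulr_ge0 ?sqr_ge0// divr_ge0.
Qed.

Lemma derive1_logpart eta : N° eta -> derive1 b eta = mean eta.
Proof. by move=> /is_derive_logpart H; rewrite derive1E derive_val. Qed.

(** The interior is open, so [derive1 b] equals [mean] near [eta]. The expansion of [m1] bounds
    [(1 + u) (d - v x)] quadratically, where [d] is the increment of the mean, and [1 + u >= 1/2]
    removes the factor. *)
Lemma derive2_logpart eta : N° eta -> derive1 (derive1 b) eta = variance eta.
Proof.
move=> Ne; have [r r0 Nr] := interior_radius Ne.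
have Nr' x : `|x| <= r -> N (eta + x) by move=> /Nr/interior_subset.
have [K [r1 [K0 r10 H]]] := centered_mgf r0 Nr'.
set v := variance eta in H *.
have v0 : 0 <= v := variance_ge0 eta.
suff D : is_derive eta (1 : R) (derive1 b) v by rewrite derive1E derive_val.
apply: (@derive1_of_quadratic_bound _ _ eta v
  (2 * (K + v * (v + K))) (Num.min (Num.min r r1) 1)).
  by rewrite !lt_min r0 r10 ltr01.
move=> x; rewrite !le_min => /andP[/andP[xr xr1] x1].
rewrite derive1_logpart; last exact: Nr.
rewrite derive1_logpart//.
have [] := H x xr1; set u := expR _ - 1 => _ h1 h2 h3.
set d := mean (eta + x) - mean eta in h1 *.
have u1 : 1 / 2 <= 1 + u by move: h3; rewrite ler_norml; lra.
have h4 : `|(1 + u) * (d - v * x)| <= (K + v * (v + K)) * `|x| ^+ 2.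
  have -> : (1 + u) * (d - v * x) = ((1 + u) * d - x * v) - x * (v * u) by ring.
  apply: le_trans (ler_normB _ _) _; rewrite [leRHS]mulrDl lerD//.
  rewrite normrM normrM (ger0_norm v0).
  apply: (@le_trans _ _ (1 * (v * `|u|))).
    by rewrite ler_wpM2r// mulr_ge0.
  by rewrite mul1r -mulrA ler_wpM2l.
move: h4; rewrite normrM ger0_norm; last lra.
rewrite real_normK ?num_real// => h4.
have := ler_wpM2r (normr_ge0 (d - v * x)) u1; lra.
Qed.

Lemma logpart_taylor eta : N° eta ->
  exists C r : R, [/\ 0 <= C, 0 < r & forall x, `|x| <= r -> N (eta + x) /\
    `|b (eta + x) - b eta - derive1 b eta * x
      - derive1 (derive1 b) eta / 2 * x ^+ 2| <= C * `|x| ^+ 3].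
Proof.
move=> Ne; have [r r0 Nr] := interior_radius Ne.
have [C [r1 [C0 r10 H]]] := logpart_taylor_moments Ne.
exists C, (Num.min r r1); split => //; first by rewrite lt_min r0.
move=> x; rewrite le_min => /andP[xr xr1]; split.
  by apply: interior_subset; exact: Nr.
by rewrite derive1_logpart// derive2_logpart//; exact: H.
Qed.

End tilted_family.

(** * One-dimensional Laplace and Gaussian integrals *)

Section lebesgue_integrals.
Variable R : realType.
Implicit Types (a k m s t : R).
Local Notation mu := (@lebesgue_measure R).

Lemma continuous_expR_affine a k : continuous (fun t : R => expR (- k * (t - a))).
Proof.
move=> t; apply: continuous_comp; last exact: continuous_expR.
by apply: cvgM; [exact: cvg_cst|apply: cvgB => //; exact: cvg_cst].
Qed.

Lemma integral_expR_ray a k : 0 < k ->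
  (\int[mu]_(t in `[a, +oo[) (expR (- k * (t - a)))%:E = (k^-1)%:E)%E.
Proof.
move=> k0.
have dF t : is_derive t (1 : R) (fun t => - k^-1 * expR (- k * (t - a)))
   (expR (- k * (t - a))).
  apply: is_derive_eq; rewrite /GRing.scale/=.
  by field; rewrite gt_eqF.
rewrite (@ge0_continuous_FTC2y _ _
  (fun t => - k^-1 * expR (- k * (t - a))) _ 0)//.
- by rewrite subrr mulr0 expR0 mulr1 EFinN oppeK add0e.
- by apply: continuous_subspaceT; exact: continuous_expR_affine.
- rewrite -(mulr0 (- k^-1)); apply: cvgM; first exact: cvg_cst.
  rewrite (_ : (fun t => _) = (fun z => expR (- z)) \o (fun t => k * (t - a))); last first.
    by apply: eq_fun => t; rewrite mulNr.
  apply: (@cvg_comp _ _ _ _ _ _ (pinfty_nbhs R)); last exact: cvgr_expR.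
  rewrite (_ : (fun t => k * (t - a)) = *%R k \o (fun t => t - a))//.
  apply: (@cvg_comp _ _ _ _ _ _ (pinfty_nbhs R)); last exact: gt0_cvgMry.
  exact: cvg_addrr.
- apply/cvg_at_right_filter; apply: cvgM; first exact: cvg_cst.
  exact: continuous_expR_affine.
- by move=> t _; rewrite derive1E; apply: derive_val.
Qed.

Lemma integral_expR_norm a k : 0 < k ->
  (\int[mu]_t (expR (- k * `|t - a|))%:E = (2 / k)%:E)%E.
Proof.
move=> k0.
have cf : continuous (fun t : R => expR (- k * `|t - a|)).
  move=> t; apply: continuous_comp; last exact: continuous_expR.
  apply: cvgM; first exact: cvg_cst.
  by apply: cvg_norm; apply: cvgB => //; exact: cvg_cst.
have mf : measurable_fun setT (fun t : R => (expR (- k * `|t - a|))%:E).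
  by apply/measurable_EFinP; exact: continuous_measurable_fun.
rewrite -(setUv `[a, +oo[%classic) ge0_integral_setU//=; last 3 first.
- exact: measurableC.
- by rewrite setUv.
- exact/disj_setPCl.
rewrite setCitvr.
have -> : (\int[mu]_(t in `[a, +oo[) (expR (- k * `|t - a|))%:E = (k^-1)%:E)%E.
  rewrite -(integral_expR_ray a k0); apply: eq_integral => t.
  by rewrite inE/= in_itv/= andbT => at_; rewrite ger0_norm// subr_ge0.
rewrite integral_itv_bndo_bndc; last exact: measurable_funS mf.
rewrite -{1}(opprK a) ge0_integration_by_substitutionNy; last 2 first.
- exact: continuous_subspaceT.
- by move=> t _; exact: expR_ge0.
have -> : (\int[mu]_(t in `[(- a)%R, +oo[)
    (((fun t => expR (- k * `|t - a|)) \o -%R) t)%:E = (k^-1)%:E)%E.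
  rewrite -(integral_expR_ray (- a) k0); apply: eq_integral => t.
  rewrite inE/= in_itv/= andbT opprK => at_; rewrite ler0_norm; last lra.
  by congr (expR _)%:E; ring.
by rewrite -EFinD mulrDl mul1r.
Qed.

(** Normal density parametrized by its precision [s], which is the form of the factors of
    [gaussdens]. *)
Definition gaussd m s t : R := Num.sqrt (s / (2 * pi)) * expR (- (s * (t - m) ^+ 2) / 2).

Lemma gaussdE m s t : 0 < s -> gaussd m s t = normal_pdf m (Num.sqrt s)^-1 t.
Proof.
move=> s0; have q0 : Num.sqrt s != 0 by rewrite gt_eqF// sqrtr_gt0.
rewrite normal_pdfE ?invr_eq0//= /gaussd; congr (_ * _).
- rewrite /normal_peak exprVn sqr_sqrtr ?ltW//.
  rewrite -[LHS]invrK -sqrtrV; last first.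
    by apply: divr_ge0; [exact: ltW|rewrite mulr_ge0// pi_ge0].
  by rewrite invf_div; congr (Num.sqrt _)^-1; rewrite -mulr_natl; ring.
- rewrite /normal_fun; congr expR; rewrite exprVn sqr_sqrtr ?ltW//.
  by rewrite -mulr_natl; field; rewrite gt_eqF.
Qed.

Lemma integral_gaussd m s : 0 < s -> (\int[mu]_t (gaussd m s t)%:E = 1)%E.
Proof.
move=> s0; under eq_integral do rewrite gaussdE//.
exact: integral_normal_pdf.
Qed.

Lemma measurable_gaussd m s : measurable_fun setT (gaussd m s).
Proof.
apply: measurable_funM => //; apply: measurableT_comp => //.
apply: measurable_funM => //; apply: measurableT_comp => //.
apply: measurable_funM => //; apply: measurable_funX.
exact: measurable_funB.
Qed.

Lemma gaussd_ge0 m s t : 0 <= gaussd m s t.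
Proof. by rewrite mulr_ge0 ?expR_ge0// sqrtr_ge0. Qed.

End lebesgue_integrals.

(** * Iterated integrals of sums of products *)

Section iterated_integral.
Variable R : realType.
Local Notation mu := (@lebesgue_measure R).

Lemma intRk_ge0 k (g : (nat -> R) -> \bar R) : (forall v, 0 <= g v)%E ->
  (0 <= intRk k g)%E.
Proof.
by elim: k g => [|k IH] g g0 //=; apply: integral_ge0 => t _; exact: IH.
Qed.

Lemma le_intRk k (g g' : (nat -> R) -> \bar R) : (forall v, 0 <= g v)%E ->
  (forall v, g v <= g' v)%E -> (intRk k g <= intRk k g')%E.
Proof.
elim: k g g' => [|k IH] g g' g0 gg' //=.
by apply: le_integral_nonmeas => t; [exact: intRk_ge0|exact: IH].
Qed.

Lemma le_intRp p (F G : ('I_p -> R) -> \bar R) : (forall v, 0 <= F v)%E ->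
  (forall v, F v <= G v)%E -> (intRp F <= intRp G)%E.
Proof. by move=> F0 FG; exact: le_intRk. Qed.

Lemma eq_intRk k (g g' : (nat -> R) -> \bar R) :
  (forall v, g v = g' v) -> intRk k g = intRk k g'.
Proof. by move=> gg'; congr intRk; exact/funext. Qed.

(** Once the outermost variable is frozen, its factor joins the coefficient, so the induction has to
    hold for all [c]. *)
Lemma intRk_sum_prod k (I : Type) (r : seq I) (c : I -> R)
    (f : I -> nat -> R -> R) (J : I -> nat -> R) :
  (forall i, 0 <= c i) -> (forall i j t, 0 <= f i j t) ->
  (forall i j, measurable_fun setT (f i j)) ->
  (forall i j, \int[mu]_t (f i j t)%:E = (J i j)%:E)%E ->
  intRk k (fun v => (\sum_(i <- r) c i * \prod_(j < k) f i j (v j))%:E) =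
  (\sum_(i <- r) c i * \prod_(j < k) J i j)%:E.
Proof.
move=> + f0 mf fJ.
have J0 i j : 0 <= J i j.
  by rewrite -lee_fin -fJ; apply: integral_ge0 => t _; rewrite lee_fin.
elim: k c => [|k IH] c c0.
  by congr EFin; apply: eq_bigr => i _; rewrite !big_ord0.
rewrite [LHS]/=.
have H t : intRk k (fun v => (\sum_(i <- r) c i * \prod_(j < k.+1)
     f i j (if nat_of_ord j == k then t else v j))%:E) =
   (\sum_(i <- r) ((c i * \prod_(j < k) J i j) * f i k t)%:E)%E.
  rewrite (@eq_intRk k _ (fun v => (\sum_(i <- r) (c i * f i k t) *
      \prod_(j < k) f i j (v j))%:E)); last first.
    move=> v; congr EFin; apply: eq_bigr => i _.
    rewrite big_ord_recr/= eqxx -mulrA (mulrC (f i k t)); congr (_ * (_ * _)).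
    by apply: eq_bigr => j _; rewrite ltn_eqF.
  rewrite IH; last by move=> i; rewrite mulr_ge0.
  by rewrite sumEFin; congr EFin; apply: eq_bigr => i _; rewrite mulrAC.
under eq_integral do rewrite H.
rewrite ge0_integral_sum//; last 2 first.
- by move=> i; apply/measurable_EFinP; apply: measurable_funM; [exact: measurable_cst|exact: mf].
- by move=> i t _; rewrite lee_fin mulr_ge0// mulr_ge0// prodr_ge0.
rewrite -sumEFin; apply: eq_bigr => i _.
under eq_integral do rewrite EFinM.
rewrite ge0_integralZl_EFin//.
- by rewrite fJ -EFinM big_ord_recr/= mulrA.
- by move=> t _; rewrite lee_fin.
- by apply/measurable_EFinP; exact: mf.
- by rewrite mulr_ge0// prodr_ge0.
Qed.

Lemma intRp_sum_prod p (I : Type) (r : seq I) (c : I -> R)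
    (f : I -> 'I_p -> R -> R) (J : I -> 'I_p -> R) :
  (forall i, 0 <= c i) -> (forall i j t, 0 <= f i j t) ->
  (forall i j, measurable_fun setT (f i j)) ->
  (forall i j, \int[mu]_t (f i j t)%:E = (J i j)%:E)%E ->
  intRp (fun v => (\sum_(i <- r) c i * \prod_j f i j (v j))%:E) =
  (\sum_(i <- r) c i * \prod_j J i j)%:E.
Proof.
move=> c0 f0 mf fJ.
(* [intRk] indexes coordinates by natural numbers; the families are extended by 0 beyond [p]. *)
pose f' i (j : nat) t := oapp (fun o => f i o t) 0 (insub j : option 'I_p).
pose J' i (j : nat) := oapp (J i) 0 (insub j : option 'I_p).
have := @intRk_sum_prod p I r c f' J' c0.
rewrite /intRp => H; rewrite [LHS](@eq_intRk p _ (fun v => (\sum_(i <- r) c i *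
    \prod_(j < p) f' i j (v j))%:E)); last first.
  move=> v; congr EFin; apply: eq_bigr => i _; congr (_ * _).
  by apply: eq_bigr => j _; rewrite /f' valK.
rewrite H.
- congr EFin; apply: eq_bigr => i _; congr (_ * _).
  by apply: eq_bigr => j _; rewrite /J' valK.
- by move=> i j t; rewrite /f'; case: insub => [l|] /=; [exact: f0|].
- move=> i j; rewrite /f'; case: insub => [l|] /=; first exact: mf.
  exact: measurable_cst.
- move=> i j; rewrite /f' /J'; case: insub => [l|] /=; first exact: fJ.
  by rewrite integral0.
Qed.

End iterated_integral.

(** * Supermartingales under the bandit dynamics *)

Section bandit_expectation.
Variables (R : realType) (p : nat) (nu : {measure set R -> \bar R}) (h : R -> R).
Variables (beta0 : 'I_p -> R) (Lambda : history R p -> 'I_p -> R).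
Hypotheses (h0 : forall y, 0 <= h y) (mh : measurable_fun setT h).
Hypothesis Lambda0 : forall H i, 0 <= Lambda H i.
Hypothesis Lambda1 : forall H, \sum_(i < p) Lambda H i = 1.
Local Notation dens := (fun i => efdens nu h (beta0 i)).
Local Notation histE := (histE nu h beta0 Lambda).

Lemma histE_ge0 k H f : (forall H', 0 <= f H')%E -> (0 <= histE k H f)%E.
Proof.
move=> f0; elim: k H => [|k IH] H //=.
apply: sume_ge0 => i _; apply: mule_ge0; first by rewrite lee_fin.
by apply: integral_ge0 => y _; rewrite mule_ge0 ?lee_fin ?efdens_ge0.
Qed.

Lemma le_histE k H f f' : (forall H', 0 <= f H')%E ->
  (forall H', size H' = (size H + k)%N -> f H' <= f' H')%E ->
  (histE k H f <= histE k H f')%E.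
Proof.
move=> f0; elim: k H => [|k IH] H ff' /=; first by apply: ff'; rewrite addn0.
apply: lee_sum => i _; apply: lee_wpmul2l; first by rewrite lee_fin.
apply: le_integral_nonmeas => y.
  by rewrite mule_ge0 ?histE_ge0// lee_fin efdens_ge0.
apply: lee_wpmul2l; first by rewrite lee_fin efdens_ge0.
by apply: IH => H' sH'; apply: ff'; rewrite sH' size_rcons addSnnS.
Qed.

(** Measurability in the newest reward is included because it is what allows [g] to be split off a
    lower integral. *)
Definition supermartingale (g : history R p -> R) := forall H,
  (forall i, measurable_fun setT (fun y => g (rcons H (i, y)))) /\
  (\sum_(i < p) (Lambda H i)%:E *
     \int[nu]_y (dens i y * g (rcons H (i, y)))%:E <= (g H)%:E)%E.

(* The (lower) integral is subadditive as soon as one summand is measurable, so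
   [f] can be arbitrary and [g] is split off step by step. *)
Lemma histE_add_supermartingale k H f g : (forall H', 0 <= f H')%E ->
  (forall H', 0 <= g H') -> supermartingale g ->
  (histE k H (fun H' => f H' + (g H')%:E) <= histE k H f + (g H)%:E)%E.
Proof.
move=> f0 g0 sg; elim: k H => [|k IH] H //=.
have [mg gH] := sg H.
apply: (@le_trans _ _ (\sum_(i < p) ((Lambda H i)%:E *
     \int[nu]_y ((dens i y)%:E * histE k (rcons H (i, y)) f) +
   (Lambda H i)%:E * \int[nu]_y (dens i y * g (rcons H (i, y)))%:E))%E);
  last first.
  by rewrite big_split/=; apply: leeD.
apply: lee_sum => i _; rewrite -ge0_muleDr; last 2 first.
- by apply: integral_ge0 => y _; rewrite mule_ge0 ?histE_ge0// lee_fin efdens_ge0.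
- by apply: integral_ge0 => y _; rewrite lee_fin mulr_ge0// efdens_ge0.
apply: lee_wpmul2l; first by rewrite lee_fin.
apply: le_trans; last first.
  apply: integralD_le_nonmeas.
  - by move=> y; rewrite mule_ge0 ?histE_ge0// lee_fin efdens_ge0.
  - by move=> y; rewrite mulr_ge0// efdens_ge0.
  - by apply: measurable_funM => //; exact: measurable_efdens.
apply: le_integral_nonmeas => y.
  rewrite mule_ge0 ?histE_ge0// ?lee_fin ?efdens_ge0// => H'.
  by rewrite adde_ge0// lee_fin.
rewrite [X in (_ <= _ + X)%E]EFinM -ge0_muleDr ?histE_ge0// ?lee_fin//.
by apply: lee_wpmul2l; rewrite ?lee_fin ?efdens_ge0.
Qed.

Lemma histE_add_sum (I : Type) (r : seq I) (g : I -> history R p -> R) k H f :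
  (forall H', 0 <= f H')%E -> (forall i H', 0 <= g i H') ->
  (forall i, supermartingale (g i)) ->
  (histE k H (fun H' => f H' + (\sum_(i <- r) g i H')%:E) <=
   histE k H f + (\sum_(i <- r) g i H)%:E)%E.
Proof.
move=> f0 g0 sg; elim: r => [|a r IH].
  rewrite big_nil adde0; apply: le_histE => [H'|H' _]; by rewrite big_nil adde0.
apply: (@le_trans _ _ (histE k H (fun H' =>
    (f H' + (\sum_(i <- r) g i H')%:E) + (g a H')%:E)))%E.
  apply: le_histE => [H'|H' _].
    by rewrite adde_ge0// lee_fin sumr_ge0.
  by rewrite big_cons (addrC (g a H')) EFinD addeA.
apply: le_trans (histE_add_supermartingale _ _ _ (g0 a) (sg a)) _.
  by move=> H'; rewrite adde_ge0// lee_fin sumr_ge0.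
by rewrite big_cons (addrC (g a H)) EFinD addeA leeD2r.
Qed.

Hypothesis Zgt0 : forall eta, (0 < \int[nu]_y (expR (eta * y) * h y)%:E)%E.
Hypothesis Nbeta0 : forall i, natparam nu h (beta0 i).

(** Likelihood ratio of [beta0 i + lam] against [beta0 i] over the pulls of arm [i], started at the
    value [c]. *)
Definition expmart (c : R) (i : 'I_p) (lam : R) (H : history R p) : R :=
  c * expR (\sum_(xy <- H | xy.1 == i)
     (lam * xy.2 - (logpart nu h (beta0 i + lam) - logpart nu h (beta0 i)))).

(** A pull of arm [i] replaces the reward density by the tilted one, and any other pull leaves the
    ratio unchanged. Every conditional integral is thus that of a probability density, and equality
    holds. *)
Lemma expmart_supermartingale c i lam : 0 <= c ->
  natparam nu h (beta0 i + lam) -> supermartingale (expmart c i lam).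
Proof.
move=> c0 Ni H; set D := (logpart nu h (beta0 i + lam) - logpart nu h (beta0 i)).
have gE k y : expmart c i lam (rcons H (k, y)) =
    expmart c i lam H * (if k == i then expR (lam * y - D) else 1).
  rewrite /expmart -cats1 big_cat/= big_cons big_nil/= -mulrA; congr (_ * _).
  by case: ifP => _; rewrite addr0 ?mulr1// expRD.
have g0 : 0 <= expmart c i lam H by rewrite mulr_ge0 ?expR_ge0.
have mk k : measurable_fun setT
    (fun y : R => if k == i then expR (lam * y - D) else 1).
  case: (k == i); last exact: measurable_cst.
  have := measurableT_comp (@measurable_expR R)
    (measurable_funB (measurable_funM (measurable_cst lam) (@measurable_id _ R setT))
      (measurable_cst D)).
  exact.
split=> [k|].
  under eq_fun do rewrite gE.
  by apply: measurable_funM => //; exact: measurable_cst.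
rewrite (eq_bigr (fun k => (Lambda H k * expmart c i lam H)%:E)).
  by rewrite sumEFin -mulr_suml Lambda1 mul1r.
move=> k _; rewrite [RHS]EFinM; congr (_ * _)%E.
pose e := if k == i then beta0 i + lam else beta0 k.
have Ne : natparam nu h e by rewrite /e; case: ifP.
have E y : dens k y * expmart c i lam (rcons H (k, y)) =
    expmart c i lam H * efdens nu h e y.
  rewrite gE /e; case: eqP => [->|_]; last by rewrite mulr1 mulrC.
  by rewrite efdensD -/D; ring.
under eq_integral do rewrite E EFinM.
rewrite ge0_integralZl_EFin//.
- by rewrite integral_efdens// mule1.
- by move=> y _; rewrite lee_fin efdens_ge0.
- by apply/measurable_EFinP; exact: measurable_efdens.
Qed.

End bandit_expectation.

(** * Fifth roots of pull counts and a summable tail *)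

Section fifth_root.
Variable R : realType.

(** With [q = m^(1/5)], the scales [m^(-2/5)], [m^(3/5)] and [m] become integer powers of [q]. *)
Definition root5 (m : nat) : R := m%:R `^ 5^-1.

Lemma root5_ge0 m : 0 <= root5 m. Proof. exact: powR_ge0. Qed.

Lemma root5X m : root5 m ^+ 5 = m%:R.
Proof.
by rewrite /root5 -powR_mulrn ?powR_ge0// -powRrM mulVf// powRr1.
Qed.

Lemma root5_ge (Q : R) m : 0 <= Q -> Q ^+ 5 <= m%:R -> Q <= root5 m.
Proof.
by move=> Q0; rewrite -root5X ler_pXn2r// nnegrE root5_ge0.
Qed.

Lemma exists_root5_ge (Q : R) : exists M : nat, forall m, (M < m)%N -> Q <= root5 m.
Proof.
pose Q' := Num.max Q 0.
have [M HM] : exists M : nat, Q' ^+ 5 <= M%:R.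
  exists (Num.truncn (Q' ^+ 5)).+1; apply/ltW; exact: truncnS_gt.
exists M => m Mm; apply: (@le_trans _ _ Q'); first by rewrite le_max lexx.
apply: root5_ge; first by rewrite le_max lexx orbT.
by apply: le_trans HM _; rewrite ler_nat ltnW.
Qed.

(* [e^q = (e^(q/10))^10 >= (q/10)^10] with [q^10 = m^2]. *)
Lemma expRN_root5_le m : (0 < m)%N ->
  expR (- root5 m) <= 10 ^+ 10 / m%:R ^+ 2.
Proof.
move=> m0; set q := root5 m.
have q0 : 0 <= q := root5_ge0 m.
have m2 : m%:R ^+ 2 = q ^+ 10 by rewrite -root5X -exprM.
have mp : 0 < m%:R ^+ 2 :> R by rewrite exprn_gt0// ltr0n.
rewrite expRN -[leRHS]invrK invf_div lef_pV2 ?posrE ?expR_gt0 ?divr_gt0//.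
rewrite m2 -expr_div_n.
have -> : expR q = expR (q / 10) ^+ 10.
  by rewrite -expRM_natl; congr expR; field.
rewrite lerXn2r ?nnegrE ?expR_ge0 ?divr_ge0//.
by apply: le_trans (expR_ge1Dx _); rewrite lerDr.
Qed.

(** Terms are at most [10^10 / m^2], and [1 / (m + 1)^2 <= 1 / m - 1 / (m + 1)] telescopes. Writing
    [maxn M n] in the induction covers the range where all terms are still zero. *)
Lemma sum_expRN_root5_le (M n : nat) : (0 < M)%N ->
  \sum_(m < n.+1) (if (M < m)%N then expR (- root5 m) else 0) <=
  10 ^+ 10 / M%:R.
Proof.
move=> M0; have Mp : 0 < M%:R :> R by rewrite ltr0n.
suff H : \sum_(m < n.+1) (if (M < m)%N then expR (- root5 m) else 0) <=
    10 ^+ 10 * (M%:R^-1 - (maxn M n)%:R^-1).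
  by apply: le_trans H _; rewrite ler_wpM2l// gerBl invr_ge0.
elim: n => [|n IH].
  by rewrite big_ord_recr big_ord0/= add0r maxn0 subrr mulr0.
rewrite big_ord_recr/=; have [Mn|Mn] := ltnP M n.+1; last first.
  rewrite addr0; apply: le_trans IH _.
  by rewrite (maxn_idPl (ltnW Mn)).
apply: le_trans (lerD IH (expRN_root5_le _)) _ => //.
have nM : (M <= n)%N by [].
rewrite (maxn_idPr nM) -mulrDr ler_wpM2l//.
have np : 0 < n%:R :> R by rewrite ltr0n (leq_trans M0).
rewrite -addrA lerD2l -natr1; set x := n%:R in np *.
have e : x^-1 - (x + 1)^-1 - (x + 1) ^- 2 = (x * (x + 1) ^+ 2)^-1.
  by field; rewrite !gt_eqF//; lra.
have : 0 <= (x * (x + 1) ^+ 2)^-1 by rewrite invr_ge0 mulr_ge0 ?sqr_ge0 ?ltW.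
by rewrite -e; lra.
Qed.

End fifth_root.

(** * Uniform deviation bound for the centered reward sums *)

Section deviation.
Variables (R : realType) (p : nat) (nu : {measure set R -> \bar R}) (h : R -> R).
Variables (beta0 : 'I_p -> R) (Lambda : history R p -> 'I_p -> R).
Hypotheses (h0 : forall y, 0 <= h y) (mh : measurable_fun setT h).
Hypothesis Lambda0 : forall H i, 0 <= Lambda H i.
Hypothesis Lambda1 : forall H, \sum_(i < p) Lambda H i = 1.
Hypothesis Zgt0 : forall eta, (0 < \int[nu]_y (expR (eta * y) * h y)%:E)%E.
Variables (mu K r : 'I_p -> R).
Local Notation b := (logpart nu h).
Hypothesis r0 : forall i, 0 < r i.
Hypothesis bK : forall i x, `|x| <= r i -> natparam nu h (beta0 i + x) /\
  b (beta0 i + x) - b (beta0 i) - mu i * x <= K i * x ^+ 2.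

Definition centered_sum (H : history R p) i : R :=
  \sum_(xy <- H | xy.1 == i) (xy.2 - mu i).

Definition deviates (H : history R p) i : bool :=
  (K i + 1) * root5 R (npulls H i) ^+ 3 < `|centered_sum H i|.

(** As [|lam| = q^-2], the linear term contributes at least [(K i + 1) q], while the curvature of
    [b] over [q^5] pulls costs at most [q^5 K i lam^2 = K i q]. The surplus [q] cancels the initial
    value [e^(-q)]. *)
Lemma expmart_ge1 i (lam q : R) H : 0 < q -> q ^+ 5 = (npulls H i)%:R ->
  `|lam| <= r i -> `|lam| = q ^- 2 ->
  (K i + 1) * q ^+ 3 <= Num.sg lam * centered_sum H i ->
  1 <= expmart nu h beta0 (expR (- q)) i lam H.
Proof.
move=> q0 qN lr lq dev; rewrite /expmart -expRD -expR0 ler_expR.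
have [_ HK] := bK lr; set D := b _ - b _ in HK *.
have -> : \sum_(xy <- H | xy.1 == i) (lam * xy.2 - D) =
    lam * centered_sum H i + q ^+ 5 * (lam * mu i - D).
  rewrite qN /centered_sum mulr_sumr mulr_natl /npulls.
  rewrite -[X in _ + X]iter_addr_0 -big_const_seq -big_split/=.
  by apply: eq_bigr => xy _; ring.
have lE : lam = Num.sg lam * q ^- 2 by rewrite -lq -numEsg.
have l2 : lam ^+ 2 = q ^- 2 * q ^- 2 by rewrite -real_normK ?num_real// lq expr2.
have h1 : (K i + 1) * q <= lam * centered_sum H i.
  have q2 : 0 <= q ^- 2 by rewrite invr_ge0 exprn_ge0// ltW.
  have := ler_wpM2l q2 dev.
  rewrite [X in _ <= X -> _](_ : _ = lam * centered_sum H i); last first.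
    by rewrite {2}lE; ring.
  by apply: le_trans; rewrite le_eqVlt; apply/orP; left; apply/eqP; field; rewrite gt_eqF.
have h2 : - (K i * q) <= q ^+ 5 * (lam * mu i - D).
  have q5 : 0 <= q ^+ 5 by rewrite exprn_ge0// ltW.
  have := ler_wpM2l q5 HK.
  have -> : q ^+ 5 * (K i * lam ^+ 2) = K i * q.
    by rewrite l2; field; rewrite gt_eqF.
  have -> : q ^+ 5 * (D - mu i * lam) = - (q ^+ 5 * (lam * mu i - D)) by ring.
  lra.
lra.
Qed.

(** Union bound over the arm, the value of its pull count and the sign of the deviation: one
    supermartingale of the finite family is at least 1 on every deviating history, and the initial
    values add up to the error term. *)
Lemma probH_deviates (M n : nat) : (0 < M)%N ->
  (forall i m, (M < m)%N -> 0 < root5 R m /\ root5 R m ^- 2 <= r i) ->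
  (probH nu h beta0 Lambda n
     (fun H => [exists i, (npulls H i <= M)%N] || [exists i, deviates H i]) <=
   probH nu h beta0 Lambda n (fun H => [exists i, (npulls H i <= M)%N]) +
   (2 * p%:R * (10 ^+ 10 / M%:R))%:E)%E.
Proof.
move=> M0 Mr.
pose T := ('I_p * 'I_n.+1 * bool)%type.
(* Counts up to [M] get weight zero and tilt zero, so they contribute nothing and their tilt stays
   within the radius. *)
pose c (m : nat) := if (M < m)%N then expR (- root5 R m) else 0.
pose l (k : T) : R := if (M < k.1.2)%N then (-1) ^+ k.2 * root5 R k.1.2 ^- 2 else 0.
pose g (k : T) := expmart nu h beta0 (c k.1.2) k.1.1 (l k).
have c0 m : 0 <= c m by rewrite /c; case: ifP; rewrite ?expR_ge0.
have g0 k H : 0 <= g k H by rewrite mulr_ge0 ?expR_ge0.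
have nl k : `|l k| <= r k.1.1.
  rewrite /l; case: ifP => Mk; last by rewrite normr0 ltW.
  rewrite normrM normrX normrN1 expr1n mul1r.
  have [q0 qr] := Mr k.1.1 _ Mk.
  by rewrite ger0_norm// invr_ge0 exprn_ge0// ltW.
have Nb i : natparam nu h (beta0 i).
  by rewrite -[beta0 i]addr0; apply: (bK _).1; rewrite normr0 ltW.
have sg k : supermartingale nu h beta0 Lambda (g k).
  by apply: expmart_supermartingale => //; apply: (bK _).1.
rewrite /probH.
apply: (@le_trans _ _ (histE nu h beta0 Lambda n [::] (fun H =>
   ([exists i, (npulls H i <= M)%N]%:R%:E + (\sum_(k : T) g k H)%:E)))%E).
  apply: le_histE => // H sH.
  rewrite -EFinD lee_fin.
  have S0 : 0 <= \sum_(k : T) g k H by rewrite sumr_ge0.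
  have [_|nE /=] := boolP [exists i, (npulls H i <= M)%N].
    by rewrite /= lerDl.
  rewrite add0r; have [/existsP[i di]|//] := boolP [exists i, deviates H i].
  set m := npulls H i.
  (* The history has length [n], so its pull count is an admissible index. *)
  have mn : (m < n.+1)%N by rewrite ltnS -[n]add0n -sH count_size.
  have Mm : (M < m)%N.
    by rewrite ltnNge; apply: contra nE => Nm; apply/existsP; exists i.
  have [q0 qr] := Mr i _ Mm.
  have gk (s : bool) : (-1) ^+ s * centered_sum H i = `|centered_sum H i| ->
      1 <= g (i, Ordinal mn, s) H.
    move=> sE; rewrite /g/= /c Mm /l/= Mm.
    have qi : 0 < root5 R m ^- 2 by rewrite invr_gt0 exprn_gt0.
    have nE' : `|(-1) ^+ s * root5 R m ^- 2| = root5 R m ^- 2.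
      by rewrite normrM normrX normrN1 expr1n mul1r gtr0_norm.
    apply: expmart_ge1 => //.
    - by rewrite root5X.
    - by rewrite nE'.
    - rewrite sgrM (gtr0_sg qi) mulr1 sgrX sgrN1 sE; exact: ltW.
  pose s := (centered_sum H i < 0).
  rewrite (bigD1 (i, Ordinal mn, s))//= (le_trans (gk s _))//.
    by rewrite -normrEsign.
  by rewrite lerDl sumr_ge0.
apply: le_trans (histE_add_sum h0 mh Lambda0 _ _ _ _ _ _) _ => //.
apply: leeD => //; rewrite lee_fin.
have -> : \sum_(k : T) g k [::] = \sum_(k : T) c k.1.2.
  by apply: eq_bigr => k _; rewrite /g /expmart big_nil expR0 mulr1.
have -> : \sum_(k : T) c k.1.2 = 2 * p%:R * \sum_(m < n.+1) c m.
  rewrite -(pair_bigA _ (fun (im : 'I_p * 'I_n.+1) (_ : bool) => c im.2))/=.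
  under eq_bigr do rewrite sumr_const card_bool.
  rewrite -(pair_bigA _ (fun (_ : 'I_p) (m : 'I_n.+1) => c m *+ 2))/=.
  rewrite sumr_const card_ord sumrMnl -(mulr_natl _ p) -(mulr_natl _ 2).
  by ring.
by rewrite ler_wpM2l ?mulr_ge0//; exact: sum_expRN_root5_le.
Qed.

End deviation.

(** * Laplace approximation of the likelihood of one arm *)

Section one_arm.
Variables (R : realType) (N : set R) (b : R -> R) (b0 mu s2 C r C0 : R).

(* Log-likelihood ratio of an arm pulled [n] times with centered reward sum [S]. *)
Definition loglr (n S x : R) : R := x * S - n * (b (b0 + x) - b b0 - mu * x).

(* The likelihood scaled by the normalizing constant of the Gaussian and by the
   value [S^2 / (2 n s2)] of the quadratic approximation at its maximum. *)
Definition scaled_lik (n S t : R) : R :=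
  Num.sqrt (n * s2 / (2 * pi)) *
  expR (loglr n S (t - b0) - S ^+ 2 / (2 * (n * s2))).

(** The center is the local MLE written with the centered sum; the precision is the diagonal entry
    of the information matrix. *)
Definition arm_gauss (n S : R) : R -> R := gaussd (b0 + S / (n * s2)) (n * s2).

(** Common majorant of likelihood and Gaussian outside the window, with the Gaussian normalizing
    constant. *)
Definition arm_tail (n k t : R) : R :=
  Num.sqrt (n * s2 / (2 * pi)) * expR (- k * `|t - b0|).

Lemma arm_laplace : 0 < s2 -> 0 <= C -> 0 < r -> 0 < C0 ->
  (forall x, `|x| <= r -> N (b0 + x) /\
    `|b (b0 + x) - b b0 - mu * x - s2 / 2 * x ^+ 2| <= C * `|x| ^+ 3) ->
  (forall x t, N (b0 + x) -> N (b0 + t * x) -> 0 <= t <= 1 ->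
     b (b0 + t * x) - b b0 <= t * (b (b0 + x) - b b0)) ->
  forall th dl : R, 0 < th -> 0 < dl -> exists Q : R, forall q S : R,
  Q <= q -> `|S| <= C0 * q ^+ 3 -> 0 < q /\ exists rho k : R,
  [/\ rho <= dl, 0 < k /\ Num.sqrt (q ^+ 5 * s2 / (2 * pi)) * (2 / k) <= th,
    forall t, `|t - b0| <= rho ->
      (1 - th) * arm_gauss (q ^+ 5) S t <= scaled_lik (q ^+ 5) S t <=
      (1 + th) * arm_gauss (q ^+ 5) S t,
    forall t, N t -> rho < `|t - b0| ->
      scaled_lik (q ^+ 5) S t <= arm_tail (q ^+ 5) k t &
    forall t, rho < `|t - b0| ->
      arm_gauss (q ^+ 5) S t <= arm_tail (q ^+ 5) k t].
Proof.
move=> s20 Cge r0 C00 taylor convex th dl th0 dl0.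
(* For a window of radius [A / q^2], this choice puts the Gaussian center within a quarter of the
   radius and makes the quadratic term at the boundary, [2 A C0 q], twice the largest linear
   term. *)
pose A := 4 * C0 / s2.
have A0 : 0 < A by rewrite divr_gt0// mulr_gt0.
have AE : s2 * A = 4 * C0 by rewrite /A; field; rewrite gt_eqF.
have lth : 0 < ln (1 + th) by rewrite ln_gt0//; lra.
(* [Q1] brings the cubic remainder below [ln (1 + th)], [Q2] below [A C0 q / 2], and [Q3] the tail
   mass below [th]; [A / dl] and [A / r] keep the window inside both radii. *)
pose Q1 := C * A ^+ 3 / ln (1 + th).
pose Q2 := 2 * C * A ^+ 2 / C0.
pose Q3 := 16 * s2 / (th ^+ 2 * C0 ^+ 2).
have Q10 : 0 <= Q1 by rewrite divr_ge0 ?(ltW lth)// mulr_ge0 ?exprn_ge0 ?(ltW A0).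
have Q20 : 0 <= Q2 by rewrite divr_ge0 ?(ltW C00)// mulr_ge0 ?exprn_ge0 ?(ltW A0)// mulr_ge0.
have Q30 : 0 <= Q3 by rewrite divr_ge0// mulr_ge0 ?sqr_ge0// ltW.
have Q40 : 0 <= A / dl by rewrite divr_ge0 ?ltW.
have Q50 : 0 <= A / r by rewrite divr_ge0 ?ltW.
exists (1 + Q1 + Q2 + Q3 + A / dl + A / r) => q S Qq Sq.
have q1 : 1 <= q by lra.
have q0 : 0 < q by lra.
have {Q10 Q20 Q30 Q40 Q50} [hQ1 hQ2 hQ3 hQ4 hQ5] :
  [/\ Q1 <= q, Q2 <= q, Q3 <= q, A / dl <= q & A / r <= q] by split; lra.
split => //.
have qn0 : q != 0 by rewrite gt_eqF.
have s2n0 : s2 != 0 by rewrite gt_eqF.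
(* The rate satisfies [k rho = A C0 q / 2], the guaranteed drop of the log-likelihood ratio at the
   window boundary. *)
pose rho := A / q ^+ 2; pose k := C0 * q ^+ 3 / 2.
have rho0 : 0 < rho by rewrite divr_gt0// exprn_gt0.
have k0 : 0 < k by rewrite divr_gt0// mulr_gt0// exprn_gt0.
have small d : 0 < d -> A / d <= q -> rho <= d.
  move=> d0 h; rewrite /rho ler_pdivrMr ?exprn_gt0//.
  move: h; rewrite ler_pdivrMr// => h; apply: le_trans h _.
  by rewrite mulrC ler_pM2l// expr2 ler_peMl// ltW.
pose n := q ^+ 5; pose s := n * s2.
have n0 : 0 < n by rewrite exprn_gt0.
have s0 : 0 < s by rewrite mulr_gt0.
pose c := Num.sqrt (s / (2 * pi)).
have pi1 : 1 <= 2 * pi :> R by have := @pi_ge2 R; lra.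
have c0 : 0 <= c := sqrtr_ge0 _.
have rem_le x : `|x| <= rho ->
    `|n * (b (b0 + x) - b b0 - mu * x - s2 / 2 * x ^+ 2)| <= C * A ^+ 3 / q.
  move=> xr; have [_ tx] := taylor x (le_trans xr (small _ r0 hQ5)).
  rewrite normrM (gtr0_norm n0).
  apply: le_trans (ler_wpM2l (ltW n0) tx) _.
  have x3 : `|x| ^+ 3 <= rho ^+ 3 by rewrite lerXn2r ?nnegrE// ltW.
  apply: le_trans (ler_wpM2l (ltW n0) (ler_wpM2l Cge x3)) _.
  rewrite le_eqVlt; apply/orP; left; apply/eqP; rewrite /n /rho.
  by field.
have Ss : `|S / s| <= rho / 4.
  rewrite normrM normfV (gtr0_norm s0) ler_pdivrMr//.
  apply: le_trans Sq _; rewrite le_eqVlt; apply/orP; left; apply/eqP.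
  by rewrite /s /n /rho /A; field; rewrite qn0.
exists rho, k; split.
- exact: small hQ4.
- split => //.
  have cle : c <= th * C0 * q ^+ 3 / 4.
    have t0 : 0 <= th * C0 * q ^+ 3 / 4.
      by rewrite divr_ge0// mulr_ge0 ?exprn_ge0 ?(ltW q0)// mulr_ge0 ?ltW.
    rewrite -[leRHS]ger0_norm// -sqrtr_sqr ler_wsqrtr//.
    apply: (@le_trans _ _ s).
      by rewrite ler_pdivrMr; [rewrite ler_peMr// ltW|lra].
    move: hQ3; rewrite /Q3 ler_pdivrMr ?mulr_gt0 ?exprn_gt0// => hQ3.
    have := ler_wpM2l (ltW n0) hQ3; rewrite /s /n => h.
    have -> : (th * C0 * q ^+ 3 / 4) ^+ 2 = q ^+ 5 * (q * (th ^+ 2 * C0 ^+ 2)) / 16 by field.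
    lra.
  have := ler_wpM2r (_ : 0 <= 2 / k) cle; rewrite divr_ge0 ?(ltW k0)// => /(_ isT).
  move=> h; apply: le_trans h _.
  rewrite le_eqVlt; apply/orP; left; apply/eqP; rewrite /k; field.
  by rewrite qn0 gt_eqF.
- move=> t tr; rewrite -/n; set x := t - b0 in tr.
  have tE : t = b0 + x by rewrite /x addrCA subrr addr0.
  (* After completing the square, likelihood and Gaussian differ exactly by [e^(-v)]. *)
  set v := n * (b (b0 + x) - b b0 - mu * x - s2 / 2 * x ^+ 2).
  have vq : `|v| <= ln (1 + th).
    apply: le_trans (rem_le x tr) _.
    by rewrite ler_pdivrMr// -ler_pdivrMl// [leLHS]mulrC.
  have -> : scaled_lik n S t = arm_gauss n S t * expR (- v).
    rewrite /scaled_lik /arm_gauss /gaussd -[RHS]mulrA -expRD; congr (_ * expR _).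
    rewrite /loglr -/x /v.
    have -> : t - (b0 + S / (n * s2)) = x - S / (n * s2) by rewrite /x; ring.
    by field; rewrite s2n0 gt_eqF.
  have g0 := gaussd_ge0 (b0 + S / s) s t.
  rewrite [(1 - th) * _]mulrC [(1 + th) * _]mulrC.
  move: vq; rewrite ler_norml => /andP[v1 v2].
  have e1 : expR (- v) <= 1 + th.
    by rewrite -[leRHS]lnK ?posrE ?ler_expR; lra.
  have e2 : (1 + th)^-1 <= expR (- v).
    by rewrite -[X in X^-1]lnK ?posrE -?expRN ?ler_expR; lra.
  have e3 : 1 - th <= (1 + th)^-1 by rewrite -div1r ler_pdivlMr; nra.
  by rewrite !ler_wpM2l// (le_trans e3 e2).
- move=> t Nt tr; rewrite /scaled_lik /arm_tail ler_wpM2l// ler_expR.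
  set x := t - b0 in tr *.
  have tE : t = b0 + x by rewrite /x addrCA subrr addr0.
  have x0 : 0 < `|x| by apply: lt_trans tr.
  apply: (@le_trans _ _ (loglr n S x)).
    by rewrite gerBl divr_ge0 ?sqr_ge0// mulr_ge0// ltW.
  (* The point [w x] lies on the window boundary; convexity of [b] carries the drop there linearly
     out to [x]. *)
  pose w := rho / `|x|.
  have w0 : 0 < w by rewrite divr_gt0.
  have w1 : w <= 1 by rewrite ler_pdivrMr// mul1r ltW.
  have wx : `|w * x| = rho.
    by rewrite normrM (gtr0_norm w0) /w divfK// gt_eqF.
  have wr : `|w * x| <= r by rewrite wx; exact: small hQ5.
  have [Nwx _] := taylor _ wr.
  have cv : b (b0 + w * x) - b b0 <= w * (b (b0 + x) - b b0).
    by apply: convex => //; rewrite -?tE// (ltW w0).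
  have h1 : w * loglr n S x <= loglr n S (w * x).
    have := ler_wpM2l (ltW n0) cv; rewrite /loglr; lra.
  have h2 : loglr n S (w * x) <= - (A * C0 * q / 2).
    have := rem_le (w * x); rewrite wx lexx => /(_ isT).
    rewrite ler_norml => /andP[+ _].
    have -> : (w * x) ^+ 2 = rho ^+ 2 by rewrite -real_normK ?num_real// wx.
    have h3 : w * x * S <= A * C0 * q.
      rewrite (le_trans (ler_norm _))// normrM wx.
      apply: le_trans (ler_wpM2l (ltW rho0) Sq) _.
      rewrite le_eqVlt; apply/orP; left; apply/eqP; rewrite /rho; field => //.
    have h4 : n * (s2 / 2 * rho ^+ 2) = 2 * A * C0 * q.
      have -> : n * (s2 / 2 * rho ^+ 2) = (s2 * A) * A * q / 2.
        by rewrite /n /rho; field.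
      by rewrite AE; field.
    have h5 : C * A ^+ 3 / q <= A * C0 * q / 2.
      rewrite ler_pdivrMr//.
      move: hQ2; rewrite /Q2 ler_pdivrMr// => hQ2.
      have q2 : q <= q * q by rewrite ler_peMl// ltW.
      have := ler_wpM2l (ltW A0) hQ2.
      have := ler_wpM2l (ltW (mulr_gt0 A0 C00)) q2.
      lra.
    rewrite /loglr; lra.
  have h3 : w * loglr n S x <= w * (- k * `|x|).
    apply: le_trans (le_trans h1 h2) _.
    rewrite le_eqVlt; apply/orP; left; apply/eqP; rewrite /w /k /rho.
    by field; rewrite qn0 gt_eqF.
  by rewrite -(ler_pM2l w0).
- move=> t tr; rewrite /arm_gauss /gaussd /arm_tail ler_wpM2l// ler_expR.
  set x := t - b0 in tr *.
  have -> : t - (b0 + S / (n * s2)) = x - S / s by rewrite /x /s; ring.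
  have x0 : 0 < `|x| by apply: lt_trans tr.
  (* The center is within [rho / 4] of [b0], hence less than [|x| / 4]. *)
  have h1 : 3 / 4 * `|x| <= `|x - S / s|.
    by apply: le_trans (lerB_dist _ _); lra.
  have h2 : (3 / 4 * `|x|) ^+ 2 <= (x - S / s) ^+ 2.
    rewrite -[leRHS]real_normK ?num_real//.
    by apply: lerXn2r; rewrite ?nnegrE ?mulr_ge0.
  have h3 : rho * `|x| <= `|x| ^+ 2 by rewrite expr2 ler_wpM2r// ltW.
  have h4 := ler_wpM2l (ltW s0) h2; have h5 := ler_wpM2l (ltW s0) h3.
  have h6 : s * (rho * `|x|) = 4 * C0 * q ^+ 3 * `|x|.
    by rewrite -AE /s /n /rho; field.
  have h7 : 0 <= C0 * q ^+ 3 * `|x|.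
    by rewrite mulr_ge0// mulr_ge0 ?exprn_ge0// ltW.
  rewrite -/s /k; lra.
Qed.

End one_arm.

(** * From one-arm bounds to the product Gaussian and the normalized posterior *)

Section posterior_vs_gaussian.
Variables (R : realType) (p : nat) (N : set R) (beta0 : 'I_p -> R).
Variables (prior lik : ('I_p -> R) -> R) (Mp W th : R).
Variables (phi tail l : 'I_p -> R -> R) (rho T : 'I_p -> R).
Local Notation mu := (@lebesgue_measure R).

(** Relative errors multiply over the arms; in the inductive step each of the at most three error
    terms is bounded by [x 3^k]. *)
Lemma expr_near1 (x : R) k : 0 <= x <= 1 ->
  1 - x * 3 ^+ k <= (1 - x) ^+ k /\ (1 + x) ^+ k <= 1 + x * 3 ^+ k.
Proof.
move=> /andP[x0 x1]; elim: k => [|k [IH1 IH2]].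
  by rewrite !expr0; split; lra.
have k1 : 1 <= 3 ^+ k :> R by rewrite exprn_ege1// ler1n.
have xk : 0 <= x * x * 3 ^+ k by rewrite !mulr_ge0//; lra.
have xk1 : x <= x * 3 ^+ k by rewrite ler_peMr.
have xxk : x * x * 3 ^+ k <= x * 3 ^+ k.
  by rewrite -mulrA ler_piMl// mulr_ge0//; lra.
rewrite !exprS; split.
- apply: le_trans (ler_wpM2l _ IH1); lra.
- apply: le_trans (ler_wpM2l _ IH2) _; lra.
Qed.

Hypothesis th01 : 0 < th <= 1.
Hypothesis prior0 : forall v, 0 <= prior v.
Hypothesis priorM : forall v, prior v <= Mp.
Hypothesis prior_beta0 : 0 < prior beta0.
Hypothesis prior_supp : forall v, prior v != 0 -> forall j, N (v j).
Hypothesis W0 : 0 < W.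
Hypothesis likE : forall v, lik v = W * \prod_j l j (v j).
Hypothesis phi0 : forall j t, 0 <= phi j t.
Hypothesis tail0 : forall j t, 0 <= tail j t.
Hypothesis l0 : forall j t, 0 <= l j t.
Hypothesis mphi : forall j, measurable_fun setT (phi j).
Hypothesis mtail : forall j, measurable_fun setT (tail j).
Hypothesis int_phi : forall j, (\int[mu]_t (phi j t)%:E = 1)%E.
Hypothesis int_tail : forall j, (\int[mu]_t (tail j t)%:E = (T j)%:E)%E.
Hypothesis T_le : forall j, T j <= th.
Hypothesis l_in : forall j t, `|t - beta0 j| <= rho j ->
  (1 - th) * phi j t <= l j t <= (1 + th) * phi j t.
Hypothesis l_out : forall j t, N t -> rho j < `|t - beta0 j| -> l j t <= tail j t.
Hypothesis phi_out : forall j t, rho j < `|t - beta0 j| -> phi j t <= tail j t.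
Hypothesis prior_in : forall v, (forall j, `|v j - beta0 j| <= rho j) ->
  (1 - th) * prior beta0 <= prior v <= (1 + th) * prior beta0.

Let pi0 := prior beta0.
Let pi0_gt0 : 0 < pi0. Proof. exact: prior_beta0. Qed.
Let prod_constE (x : R) : x ^+ p = \prod_(j < p) x.
Proof. by rewrite prodr_const card_ord. Qed.
Let th0 : 0 <= th. Proof. by case/andP: th01 => /ltW. Qed.
Let th1 : th <= 1. Proof. by case/andP: th01. Qed.

Definition gaussp v := \prod_j phi j (v j).
(** Majorant for points whose coordinate [i] leaves its window: for the other coordinates,
    [2 phi + tail] dominates both [phi] and [l] inside and outside the window, because [th <= 1]. *)
Definition slab i v := \prod_j (if j == i then tail j (v j)
  else 2 * phi j (v j) + tail j (v j)).
Definition envelope (a d : R) v := a * gaussp v + \sum_i d * slab i v.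

Lemma envelopeM k a d v : envelope (k * a) (k * d) v = k * envelope a d v.
Proof.
rewrite /envelope mulrDr mulrA mulr_sumr; congr (_ + _).
by apply: eq_bigr => i _; rewrite mulrA.
Qed.

Lemma envelopeD a a' d v : envelope (a + a') d v = envelope a d v + a' * gaussp v.
Proof. by rewrite /envelope mulrDl addrAC. Qed.

Lemma gaussp_ge0 v : 0 <= gaussp v.
Proof. exact: prodr_ge0. Qed.

Lemma slab_ge0 i v : 0 <= slab i v.
Proof.
by apply: prodr_ge0 => j _; case: ifP => // _; rewrite addr_ge0// mulr_ge0.
Qed.

Lemma T_ge0 j : 0 <= T j.
Proof.
by rewrite -lee_fin -int_tail; apply: integral_ge0 => t _; rewrite lee_fin.
Qed.

(** Each slab has one factor of mass at most [th], and the others have mass at most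
    [2 + th <= 3]. *)
Lemma intRp_gaussp_envelope a d : 0 <= a -> 0 <= d ->
  (intRp (fun v => (envelope a d v)%:E) <= (a + p%:R * (d * (th * 3 ^+ p)))%:E)%E.
Proof.
move=> a0 d0.
(* Index [None] is the Gaussian term and [Some i] the slab of coordinate [i]. *)
pose f (k : option 'I_p) j t := if k is Some i then
  (if j == i then tail j t else 2 * phi j t + tail j t) else phi j t.
pose J (k : option 'I_p) j := if k is Some i then
  (if j == i then T j else 2 + T j) else 1.
pose c (k : option 'I_p) := if k is Some i then d else a.
pose s := None :: [seq Some i | i <- index_enum 'I_p].
have -> : (fun v => (envelope a d v)%:E) =
    (fun v => (\sum_(k <- s) c k * \prod_j f k j (v j))%:E).
  by apply/funext => v; rewrite big_cons big_map.
rewrite (@intRp_sum_prod _ _ _ s c f J).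
- rewrite lee_fin big_cons big_map/= big1_eq mulr1 lerD2l.
  apply: (@le_trans _ _ (\sum_(i < p) d * (th * 3 ^+ p))); last first.
    by rewrite sumr_const card_ord mulr_natl.
  apply: ler_sum => i _; rewrite ler_wpM2l//.
  rewrite (bigD1 i)//= eqxx ler_pM// ?T_ge0//.
    by apply: prodr_ge0 => j _; case: ifP => _; rewrite ?addr_ge0 ?T_ge0.
  apply: (@le_trans _ _ (\prod_(j < p | j != i) 3)).
    apply: ler_prod => j /negbTE ->; rewrite addr_ge0 ?T_ge0//=.
    have := T_le j; have := th1; lra.
  rewrite prodr_const; apply: ler_weXn2l; first by rewrite ler1n.
  by rewrite -[leqRHS]card_ord max_card.
- by case.
- move=> [i|] j t //=; case: ifP => // _.
  by rewrite addr_ge0// mulr_ge0.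
- move=> [i|] j; rewrite /f; last exact: mphi.
  case: (j == i); first exact: mtail.
  by apply: measurable_funD; [apply: measurable_funM; [exact: measurable_cst|exact: mphi]|exact: mtail].
- move=> [i|] j; rewrite /f /J; last exact: int_phi.
  case: (j == i); first exact: int_tail.
  under eq_integral do rewrite EFinD EFinM.
  rewrite ge0_integralD//.
  + rewrite ge0_integralZl_EFin//.
    * by rewrite int_phi int_tail mule1.
    * by move=> t _; rewrite lee_fin.
    * by apply/measurable_EFinP; exact: mphi.
  + by move=> t _; rewrite -EFinM lee_fin mulr_ge0.
  + by apply: measurable_funeM; apply/measurable_EFinP; exact: mphi.
  + by move=> t _; rewrite lee_fin.
  + by apply/measurable_EFinP; exact: mtail.
Qed.

Definition scaled v := prior v / pi0 * \prod_j l j (v j).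

Let e1 := th * 3 ^+ p.+1.
Let M' := Mp / pi0 + 1.

Let Mpi : 1 <= Mp / pi0.
Proof. by rewrite ler_pdivlMr; [rewrite mul1r; exact: priorM|exact: pi0_gt0]. Qed.

Lemma inside_or_outside v : (forall j, `|v j - beta0 j| <= rho j) \/
  exists i, rho i < `|v i - beta0 i|.
Proof.
have [/forallP|] := boolP [forall j, `|v j - beta0 j| <= rho j]; first by left.
by rewrite negb_forall => /existsP[i]; rewrite -ltNge; right; exists i.
Qed.

Lemma scaled_inside v : (forall j, `|v j - beta0 j| <= rho j) ->
  (1 - e1) * gaussp v <= scaled v <= (1 + e1) * gaussp v.
Proof.
move=> vin; have /andP[p1 p2] := prior_in vin.
have G0 := gaussp_ge0 v.
have t01 : 0 <= th <= 1 by rewrite th0 th1.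
have [h1 h2] := expr_near1 p.+1 t01.
have r1 : 1 - th <= prior v / pi0 by rewrite ler_pdivlMr.
have r2 : prior v / pi0 <= 1 + th by rewrite ler_pdivrMr.
have L1 : (1 - th) ^+ p * gaussp v <= \prod_j l j (v j).
  rewrite /gaussp prod_constE -big_split/=.
  apply: ler_prod => j _; have /andP[-> _] := l_in (vin j).
  by rewrite mulr_ge0// subr_ge0.
have L2 : \prod_j l j (v j) <= (1 + th) ^+ p * gaussp v.
  rewrite /gaussp prod_constE -big_split/=.
  by apply: ler_prod => j _; have /andP[_ ->] := l_in (vin j); rewrite l0.
have x0 : 0 <= prior v / pi0 by rewrite divr_ge0// ltW.
apply/andP; split.
- apply: le_trans (ler_wpM2r G0 h1) _; rewrite exprS -mulrA.
  apply: ler_pM => //; rewrite ?subr_ge0// mulr_ge0 ?exprn_ge0//.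
  by rewrite subr_ge0.
- apply: le_trans _ (ler_wpM2r G0 h2); rewrite exprS -mulrA.
  by apply: ler_pM => //; exact: prodr_ge0.
Qed.

Lemma scaled_ge0 v : 0 <= scaled v.
Proof. by rewrite mulr_ge0 ?prodr_ge0// divr_ge0// ltW. Qed.

(** If all coordinates are in their windows, the relative errors of prior and arms combine to [e1].
    Otherwise both functions are bounded by the slab of an offending coordinate. *)
Lemma scaled_gaussp_dist v : `|scaled v - gaussp v| <= envelope e1 M' v.
Proof.
have G0 := gaussp_ge0 v; have s0 := scaled_ge0 v.
have M0 : 0 <= M' by rewrite /M'; have := Mpi; lra.
have e0 : 0 <= e1 by rewrite mulr_ge0// exprn_ge0.
have S0 i : 0 <= M' * slab i v by rewrite mulr_ge0// slab_ge0.
have [vin|[i vi]] := inside_or_outside v.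
  have /andP[a b] := scaled_inside vin.
  apply: (@le_trans _ _ (e1 * gaussp v)).
    by rewrite ler_norml; apply/andP; split; lra.
  by rewrite /envelope lerDl sumr_ge0.
have Gs : gaussp v <= slab i v.
  apply: ler_prod => j _; rewrite phi0/=; case: eqP => [->|_].
    exact: phi_out.
  by have := phi0 j (v j); have := tail0 j (v j); lra.
have As : scaled v <= Mp / pi0 * slab i v.
  rewrite /scaled; have [->|pv] := eqVneq (prior v) 0.
    by rewrite !mul0r mulr_ge0 ?slab_ge0//; have := Mpi; lra.
  apply: ler_pM.
  - by rewrite divr_ge0// ltW.
  - exact: prodr_ge0.
  - by rewrite ler_pM2r ?invr_gt0.
  apply: ler_prod => j _; rewrite l0/=; case: eqP => [->|_].
    by apply: l_out => //; exact: prior_supp.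
  have [vj|vj] := leP `|v j - beta0 j| (rho j).
    have /andP[_ h] := l_in vj; apply: le_trans h _.
    have a := phi0 j (v j); have b := tail0 j (v j).
    have := ler_wpM2r a th1; lra.
  apply: le_trans (l_out (prior_supp pv j) vj) _.
  by have := phi0 j (v j); lra.
apply: (@le_trans _ _ (M' * slab i v)).
  have := slab_ge0 i v; rewrite /M' mulrDl mul1r ler_norml.
  by move=> ?; apply/andP; split; lra.
rewrite /envelope (bigD1 i)//= addrCA lerDl addr_ge0//.
  by rewrite mulr_ge0.
exact: sumr_ge0.
Qed.

Lemma prior_likE v : prior v * lik v = W * pi0 * scaled v.
Proof.
rewrite likE /scaled; field.
by rewrite gt_eqF.
Qed.

(** A measurable minorant of [phi] that vanishes outside the window, where [phi <= tail], and loses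
    at most the mass of [tail]. It plays the part of a truncation to the window. *)
Let psi j t := Num.max (phi j t - tail j t) 0.

Lemma integral_psi j : exists2 J : R, 1 - th <= J &
  (\int[mu]_t (psi j t)%:E = J%:E)%E.
Proof.
have mpsi : measurable_fun setT (psi j).
  by apply: measurable_maxr; [apply: measurable_funB; [exact: mphi|exact: mtail]|exact: measurable_cst].
have psi0 t : 0 <= psi j t by rewrite le_max lexx orbT.
have up : (\int[mu]_t (psi j t)%:E <= 1)%E.
  rewrite -(int_phi j); apply: le_integral_nonmeas => t; rewrite lee_fin//.
  by rewrite ge_max phi0 gerBl tail0.
have f : (\int[mu]_t (psi j t)%:E)%E \is a fin_num.
  rewrite ge0_fin_numE ?(le_lt_trans up) ?ltry//.
  by apply: integral_ge0 => t _; rewrite lee_fin.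
exists (fine (\int[mu]_t (psi j t)%:E)%E); last by rewrite fineK.
have : (1 <= \int[mu]_t (psi j t)%:E + (T j)%:E)%E.
  rewrite -int_tail -(int_phi j) -ge0_integralD//; last 4 first.
  - by move=> t _; rewrite lee_fin.
  - exact/measurable_EFinP.
  - by move=> t _; rewrite lee_fin.
  - by apply/measurable_EFinP; exact: mtail.
  apply: le_integral_nonmeas => t; first by rewrite lee_fin.
  by rewrite -EFinD lee_fin -lerBlDr le_max lexx.
rewrite -[X in (_ <= X + _)%E]fineK// -EFinD lee_fin.
by have := T_le j; lra.
Qed.

Definition tv_error := e1 + p%:R * (M' * (th * 3 ^+ p)).

(** The envelope gives the upper bound. The product of the [psi] gives the lower one, via [(1 - e1)
    (1 - th)^p >= (1 - e1)^2 >= 1 - 2 e1]. *)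
Lemma normalizer_bounds : tv_error <= 1 / 4 ->
  exists2 z : R, 1 - 2 * tv_error <= z <= 1 + tv_error &
  intRp (fun v => (prior v * lik v)%:E) = (W * pi0 * z)%:E.
Proof.
move=> small.
have Wp : 0 < W * pi0 by rewrite mulr_gt0.
have M0 : 0 <= M' by rewrite /M'; have := Mpi; lra.
have e0 : 0 <= e1 by rewrite mulr_ge0// exprn_ge0.
have t30 : 0 <= p%:R * (M' * (th * 3 ^+ p)).
  by rewrite mulr_ge0// mulr_ge0// mulr_ge0// exprn_ge0.
have e1s : e1 <= tv_error by rewrite /tv_error lerDl.
have up : (intRp (fun v => (prior v * lik v)%:E) <=
    (W * pi0 * (1 + tv_error))%:E)%E.
  apply: (@le_trans _ _ (intRp (fun v =>
     (envelope (W * pi0 * (1 + e1)) (W * pi0 * M') v)%:E))).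
    apply: le_intRp => v; rewrite lee_fin prior_likE.
      by rewrite mulr_ge0 ?scaled_ge0 ?(ltW Wp).
    have := scaled_gaussp_dist v; rewrite ler_norml => /andP[_ h].
    have -> : envelope (W * pi0 * (1 + e1)) (W * pi0 * M') v =
        W * pi0 * (envelope e1 M' v + gaussp v).
      by rewrite envelopeM (addrC 1) envelopeD mul1r.
    by rewrite ler_pM2l//; lra.
  apply: le_trans (intRp_gaussp_envelope _ _) _.
  - by rewrite mulr_ge0 ?(ltW Wp)//; lra.
  - by rewrite mulr_ge0 ?(ltW Wp).
  - rewrite lee_fin /tv_error le_eqVlt; apply/orP; left; apply/eqP; ring.
have /choice[J HJ] : forall j, exists J : R, 1 - th <= J /\
    (\int[mu]_t (psi j t)%:E = J%:E)%E.
  by move=> j; have [J ? ?] := integral_psi j; exists J.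
have lo : ((W * pi0 * ((1 - e1) * (1 - th) ^+ p))%:E <=
    intRp (fun v => (prior v * lik v)%:E))%E.
  have we : 0 <= W * pi0 * (1 - e1) by rewrite mulr_ge0 ?(ltW Wp)//; lra.
  have psi0 j t : 0 <= psi j t by rewrite le_max lexx orbT.
  apply: (@le_trans _ _ (intRp (fun v =>
     (\sum_(k <- [:: tt]) W * pi0 * (1 - e1) * \prod_j psi j (v j))%:E))).
    rewrite (@intRp_sum_prod _ _ _ [:: tt] (fun=> W * pi0 * (1 - e1))
      (fun=> psi) (fun=> J))//.
    - rewrite lee_fin big_seq1 mulrA ler_wpM2l//.
      rewrite prod_constE; apply: ler_prod => j _.
      by rewrite subr_ge0 th1 (HJ j).1.
    - move=> _ j; apply: measurable_maxr; last exact: measurable_cst.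
      by apply: measurable_funB; [exact: mphi|exact: mtail].
    - by move=> _ j; exact: (HJ j).2.
  apply: le_intRp => v; rewrite big_seq1 lee_fin.
    by rewrite mulr_ge0// prodr_ge0.
  rewrite prior_likE -mulrA ler_pM2l//.
  have [vin|[i vi]] := inside_or_outside v.
    have /andP[a _] := scaled_inside vin; apply: le_trans _ a.
    rewrite ler_wpM2l//; first by lra.
    apply: ler_prod => j _; rewrite psi0 ge_max phi0 gerBl tail0//.
  rewrite (bigD1 i)//= [psi i (v i)](_ : _ = 0) ?mul0r ?mulr0 ?scaled_ge0//.
  by apply/max_idPr; rewrite subr_le0 phi_out.
have f : intRp (fun v => (prior v * lik v)%:E) \is a fin_num.
  rewrite fin_numElt (lt_le_trans _ lo) ?ltNyr// (le_lt_trans up) ?ltry//.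
move: f lo up; case: (intRp _) => [x| |]// _; rewrite !lee_fin => lo up.
exists (x / (W * pi0)); last by rewrite mulrC divfK ?gt_eqF.
apply/andP; split; last by rewrite ler_pdivrMr// [leRHS]mulrC.
rewrite ler_pdivlMr// [leLHS]mulrC; apply: le_trans _ lo; rewrite ler_pM2l//.
have t01 : 0 <= th <= 1 by rewrite th0 th1.
have [h1 _] := expr_near1 p t01.
have e1p : th * 3 ^+ p <= e1.
  by rewrite /e1 exprS mulrCA ler_peMl ?mulr_ge0 ?exprn_ge0// ler1n.
have h2 : 1 - e1 <= (1 - th) ^+ p by lra.
have := ler_wpM2l (_ : 0 <= 1 - e1) h2; rewrite subr_ge0.
have e11 : e1 <= 1 by lra.
move=> /(_ e11); apply: le_trans; nra.
Qed.

(** With [z] the relative normalizer, the difference is [((scaled - gaussp) + (1 - z) gaussp) / z],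
    where [z >= 1/2] and [|1 - z| <= 2 tv_error]. The two parts contribute [2 tv_error] and
    [4 tv_error]. *)
Lemma posterior_gaussian_tv : tv_error <= 1 / 4 ->
  (intRp (fun v => `|prior v * lik v /
      fine (intRp (fun v => (prior v * lik v)%:E)) - gaussp v|%:E) <=
   (6 * tv_error)%:E)%E.
Proof.
move=> small; have [z /andP[z1 z2] ->] := normalizer_bounds small.
have Wp : 0 < W * pi0 by rewrite mulr_gt0.
have M0 : 0 <= M' by rewrite /M'; have := Mpi; lra.
have e0 : 0 <= e1 by rewrite mulr_ge0// exprn_ge0.
have t30 : 0 <= p%:R * (M' * (th * 3 ^+ p)).
  by rewrite mulr_ge0// mulr_ge0// mulr_ge0// exprn_ge0.
have err0 : 0 <= tv_error by rewrite addr_ge0.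
have zh : 1 / 2 <= z by lra.
apply: (@le_trans _ _ (intRp (fun v =>
   (envelope (2 * e1 + 4 * tv_error) (2 * M') v)%:E))).
  apply: le_intRp => v; rewrite lee_fin// prior_likE /=.
  have -> : W * pi0 * scaled v / (W * pi0 * z) - gaussp v =
     ((scaled v - gaussp v) + (1 - z) * gaussp v) / z.
    field; rewrite !gt_eqF//; lra.
  rewrite normrM normfV (@ger0_norm _ z); last lra.
  rewrite ler_pdivrMr; last lra.
  apply: le_trans (ler_normD _ _) _.
  have -> : envelope (2 * e1 + 4 * tv_error) (2 * M') v =
      2 * envelope e1 M' v + 4 * tv_error * gaussp v.
    by rewrite envelopeD envelopeM.
  have G0 := gaussp_ge0 v; have h1 := scaled_gaussp_dist v.
  have E0 := le_trans (normr_ge0 _) h1.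
  have h2 : `|(1 - z) * gaussp v| <= 2 * tv_error * gaussp v.
    rewrite normrM (ger0_norm G0) ler_wpM2r// ler_norml.
    by apply/andP; split; lra.
  have GG : 0 <= tv_error * gaussp v by rewrite mulr_ge0.
  apply: le_trans (lerD h1 h2) _.
  have X0 : 0 <= 2 * envelope e1 M' v + 4 * tv_error * gaussp v by lra.
  apply: le_trans (ler_wpM2l X0 zh); lra.
apply: le_trans (intRp_gaussp_envelope _ _) _; [by lra|by lra|].
by rewrite lee_fin /tv_error; lra.
Qed.

End posterior_vs_gaussian.

(** * Continuity in the product topology expressed on boxes *)

(** The filter generated by boxes around [x] converges to [x] in every coordinate, hence in the
    product topology, and continuity of [g] applies to it. *)
Lemma continuous_prod_box (R : realType) (p : nat) (g : ('I_p -> R) -> R)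
    (x : 'I_p -> R) (e : R) :
  continuous (g : prod_topology (fun _ : 'I_p => R) -> R) -> 0 < e ->
  exists2 d : R, 0 < d & forall v, (forall j, `|v j - x j| <= d) ->
    `|g v - g x| <= e.
Proof.
move=> cg e0.
pose F : set_system ('I_p -> R) := [set A | exists2 d : R, 0 < d &
  forall v, (forall j, `|v j - x j| <= d) -> A v].
have FF : Filter F.
  split.
  - by exists 1.
  - move=> A B [a a0 HA] [b b0 HB]; exists (Num.min a b); first by rewrite lt_min a0.
    move=> v Hv; split; [apply: HA|apply: HB] => j;
      by have := Hv j; rewrite le_min => /andP[].
  - by move=> A B AB [a a0 HA]; exists a => // v /HA/AB.
have Fx : F --> (x : prod_topology (fun _ : 'I_p => R)).
  apply/cvg_sup => j; rewrite cvg_image; last first.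
    by rewrite eqEsubset; split=> v // _; exists (cst v).
  move=> A /nbhs_ballP[a /= a0 HA].
  exists (@^~ j @^-1` A); last first.
    by rewrite eqEsubset; split=> [y [? + <-//]|y Ay]; exists (fun=> y).
  exists (a / 2); first by rewrite divr_gt0.
  move=> v Hv; apply: HA; rewrite /ball/= distrC (le_lt_trans (Hv j))//.
  by rewrite ltr_pdivrMr// ltr_pMr// ltr1n.
have := cvg_trans (cvg_app g Fx) (cg x).
move=> /cvgrPdist_le/(_ e e0)[d d0 H].
by exists d => // v /H /=; rewrite distrC.
Qed.

(** * Factorization of the likelihood over the arms *)

Section factorization.
Variables (R : realType) (p : nat) (b : R -> R) (beta0 mu s2 : 'I_p -> R).
Variable H : history R p.
Local Notation n j := ((npulls H j)%:R : R).
Local Notation S j := (centered_sum mu H j).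

Lemma sum_arm_const j (c : R) : \sum_(xy <- H | xy.1 == j) c = n j * c.
Proof. by rewrite big_const_seq iter_addr_0 mulr_natl. Qed.

Lemma centered_sumE j : S j = \sum_(xy <- H | xy.1 == j) xy.2 - n j * mu j.
Proof. by rewrite -sum_arm_const -sumrB. Qed.

Lemma sum_arm_loglik j (t : R) :
  \sum_(xy <- H | xy.1 == j) (t * xy.2 - b t) =
  loglr b (beta0 j) (mu j) (n j) (S j) (t - beta0 j) +
  (beta0 j * S j + n j * (beta0 j * mu j) - n j * b (beta0 j)).
Proof.
rewrite sumrB sum_arm_const -mulr_sumr /loglr centered_sumE.
by rewrite [_ + (t - _)]addrCA subrr addr0; ring.
Qed.

Lemma lik_factorization : (forall j, 0 < s2 j) ->
  (forall j, (0 < npulls H j)%N) -> exists2 W : R, 0 < W & forall v,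
  \prod_(xy <- H) expR (v xy.1 * xy.2 - b (v xy.1)) =
  W * \prod_j scaled_lik b (beta0 j) (mu j) (s2 j) (n j) (S j) (v j).
Proof.
move=> s20 n0.
pose c j : R := Num.sqrt (n j * s2 j / (2 * pi)).
have c0 j : 0 < c j.
  rewrite sqrtr_gt0 divr_gt0 ?mulr_gt0 ?ltr0n//.
  exact: pi_gt0.
(* Part of the log-likelihood of arm [j] that is free of [v], plus the term [S^2 / (2 n s2)]
   subtracted in [scaled_lik]. *)
pose a j := beta0 j * S j + n j * (beta0 j * mu j) - n j * b (beta0 j) +
  S j ^+ 2 / (2 * (n j * s2 j)).
exists (\prod_j (expR (a j) / c j)).
  by apply: prodr_gt0 => j _; rewrite divr_gt0 ?expR_gt0.
move=> v; rewrite -big_split/=.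
rewrite -(big_morph expR (@expRD R) (@expR0 R)).
rewrite (partition_big (fun xy => xy.1) predT)//=.
rewrite (big_morph expR (@expRD R) (@expR0 R)).
apply: eq_bigr => j _.
have -> : \sum_(xy <- H | xy.1 == j) (v xy.1 * xy.2 - b (v xy.1)) =
   \sum_(xy <- H | xy.1 == j) (v j * xy.2 - b (v j)).
  by apply: eq_bigr => xy /eqP ->.
rewrite sum_arm_loglik /scaled_lik -/(c j) [RHS]mulrA divfK; last by rewrite gt_eqF.
by rewrite -expRD; congr expR; rewrite /a; ring.
Qed.

End factorization.

(** * Total variation bound on histories without deviation *)

Section deterministic.
Variables (R : realType) (p : nat) (nu : {measure set R -> \bar R}) (h : R -> R).
Variables (beta0 : 'I_p -> R) (prior : ('I_p -> R) -> R).
Local Notation b := (logpart nu h).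
Local Notation mu := (fun i => derive1 b (beta0 i)).
Local Notation s2 := (fun i => derive1 (derive1 b) (beta0 i)).
Hypothesis s20 : forall i, 0 < s2 i.

Lemma gaussdensE H v : (forall j, (0 < npulls H j)%N) ->
  gaussdens nu h beta0 H v = \prod_j arm_gauss (beta0 j) (s2 j)
    (npulls H j)%:R (centered_sum mu H j) (v j).
Proof.
move=> n0; apply: eq_bigr => j _ /=.
rewrite /arm_gauss /gaussd; congr (_ * expR (- (_ * (_ - _) ^+ 2) / 2)).
rewrite /betahat /ybar /=; congr (_ + _); rewrite centered_sumE/=.
have nj : (npulls H j)%:R != 0 :> R by rewrite pnatr_eq0 -lt0n.
have sj : derive1 (derive1 b) (beta0 j) != 0 by rewrite gt_eqF//; exact: s20.
move: (derive1 (derive1 b) (beta0 j)) (derive1 b (beta0 j)) sj => s m sj.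
by field; rewrite nj sj.
Qed.

Variables (C r K : 'I_p -> R).
Hypothesis C_ge0 : forall i, 0 <= C i.
Hypothesis r_gt0 : forall i, 0 < r i.
Hypothesis K_ge0 : forall i, 0 <= K i.
Hypothesis taylor : forall i x, `|x| <= r i -> natparam nu h (beta0 i + x) /\
  `|b (beta0 i + x) - b (beta0 i) - mu i * x - s2 i / 2 * x ^+ 2| <=
    C i * `|x| ^+ 3.
Hypothesis convex : forall i x t, natparam nu h (beta0 i + x) ->
  natparam nu h (beta0 i + t * x) -> 0 <= t <= 1 ->
  b (beta0 i + t * x) - b (beta0 i) <= t * (b (beta0 i + x) - b (beta0 i)).
Hypothesis prior0 : forall v, 0 <= prior v.
Hypothesis cprior : continuous (prior : prod_topology (fun _ : 'I_p => R) -> R).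
Hypothesis prior_bounded : exists M : R, forall v, prior v <= M.
Hypothesis prior_supp : forall v, prior v != 0 -> forall i, natparam nu h (v i).
Hypothesis prior_beta0 : 0 < prior beta0.

Lemma tvdist_le_eps (eps : R) : 0 < eps -> exists M0 : nat, forall H,
  (forall i, (M0 < npulls H i)%N) -> (forall i, ~~ deviates mu K H i) ->
  (tvdist nu h beta0 prior H <= eps%:E)%E.
Proof.
move=> eps0; have [Mp priorM] := prior_bounded.
(* [B] is the factor in [tv_error = th * B]; [th] is then taken small enough for
   [tv_error <= min (1/4) (eps/6)]. *)
pose B : R := 3 ^+ p.+1 + p%:R * ((Mp / prior beta0 + 1) * 3 ^+ p).
have Mp0 : 0 <= Mp / prior beta0.
  by rewrite divr_ge0 ?(ltW prior_beta0)// (le_trans (prior0 beta0)).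
have B0 : 0 <= B.
  by rewrite addr_ge0 ?exprn_ge0// mulr_ge0// mulr_ge0 ?exprn_ge0// addr_ge0.
pose th := Num.min 1 (Num.min (1 / 4) (eps / 6) / (B + 1)).
have m0 : 0 < Num.min (1 / 4) (eps / 6) by rewrite lt_min !divr_gt0.
have th0 : 0 < th.
  by rewrite lt_min ltr01/= divr_gt0//; lra.
have th1 : th <= 1 by rewrite ge_min lexx.
have thB : th * B <= Num.min (1 / 4) (eps / 6).
  have : th <= Num.min (1 / 4) (eps / 6) / (B + 1) by rewrite ge_min lexx orbT.
  rewrite ler_pdivlMr; last lra.
  apply: le_trans; rewrite ler_wpM2l ?(ltW th0)//; lra.
have errE : tv_error beta0 prior Mp th = th * B.
  by rewrite /tv_error /B; ring.
have tp0 : 0 < th * prior beta0 by rewrite mulr_gt0.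
(* Every window will have radius at most [dl], so the prior is within a factor [1 + th] or [1 - th]
   of its value at [beta0] on their product. *)
have [dl dl0 Hdl] := continuous_prod_box beta0 cprior tp0.
have Kp i : 0 < K i + 1 by have := K_ge0 i; lra.
have /choice[Q HQ] := fun i => arm_laplace (s20 i) (C_ge0 i) (r_gt0 i) (Kp i)
  (taylor (i := i)) (convex (i := i)) th0 dl0.
have /choice[M1 HM1] := fun i => exists_root5_ge (Q i).
exists (\max_i M1 i)%N => H NM ndev.
have n0 j : (0 < npulls H j)%N by exact: leq_ltn_trans (NM j).
have /choice[rho /choice[k Hrk]] : forall j, exists rho k : R,
  [/\ rho <= dl, 0 < k /\ Num.sqrt ((npulls H j)%:R * s2 j / (2 * pi)) * (2 / k) <= th,
    forall t, `|t - beta0 j| <= rho ->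
      (1 - th) * arm_gauss (beta0 j) (s2 j) (npulls H j)%:R (centered_sum mu H j) t <=
      scaled_lik b (beta0 j) (mu j) (s2 j) (npulls H j)%:R (centered_sum mu H j) t <=
      (1 + th) * arm_gauss (beta0 j) (s2 j) (npulls H j)%:R (centered_sum mu H j) t,
    forall t, natparam nu h t -> rho < `|t - beta0 j| ->
      scaled_lik b (beta0 j) (mu j) (s2 j) (npulls H j)%:R (centered_sum mu H j) t <=
      arm_tail (beta0 j) (s2 j) (npulls H j)%:R k t &
    forall t, rho < `|t - beta0 j| ->
      arm_gauss (beta0 j) (s2 j) (npulls H j)%:R (centered_sum mu H j) t <=
      arm_tail (beta0 j) (s2 j) (npulls H j)%:R k t].
  move=> j; rewrite -(root5X R (npulls H j)).
  have Qq : Q j <= root5 R (npulls H j).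
    by apply: HM1; apply: leq_ltn_trans (NM j); exact: leq_bigmax.
  have Sq : `|centered_sum mu H j| <= (K j + 1) * root5 R (npulls H j) ^+ 3.
    by rewrite leNgt; exact: ndev.
  have [_ HH] := HQ j _ _ Qq Sq.
  exact: HH.
have [W W0 likE] := lik_factorization b beta0 mu s20 n0.
have tl0 j : 0 <= 2 / k j by rewrite divr_ge0// ltW//; case: (Hrk j) => _ [].
have np j : 0 < (npulls H j)%:R * s2 j by rewrite mulr_gt0 ?ltr0n.
have main := @posterior_gaussian_tv R p (natparam nu h) beta0 prior
  (lik nu h H) Mp W th
  (fun j => arm_gauss (beta0 j) (s2 j) (npulls H j)%:R (centered_sum mu H j))
  (fun j => arm_tail (beta0 j) (s2 j) (npulls H j)%:R (k j))
  (fun j => scaled_lik b (beta0 j) (mu j) (s2 j) (npulls H j)%:R (centered_sum mu H j))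
  rho (fun j => Num.sqrt ((npulls H j)%:R * s2 j / (2 * pi)) * (2 / k j)).
have {main} : (intRp (fun v => `|posterior nu h prior H v -
    gaussdens nu h beta0 H v|%:E) <= (6 * tv_error beta0 prior Mp th)%:E)%E.
  under [X in intRp X]funext do rewrite gaussdensE//.
  apply: main => //.
  - by rewrite th0.
  - by move=> j t; exact: gaussd_ge0.
  - by move=> j t; rewrite mulr_ge0 ?expR_ge0// sqrtr_ge0.
  - by move=> j t; rewrite mulr_ge0 ?expR_ge0// sqrtr_ge0.
  - by move=> j; exact: measurable_gaussd.
  - move=> j; apply: measurable_funM; first exact: measurable_cst.
    apply: measurableT_comp => //; apply: measurable_funM => //.
    by apply: measurableT_comp => //; exact: measurable_funB.
  - by move=> j; exact: integral_gaussd.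
  - move=> j; rewrite /arm_tail; under eq_integral do rewrite EFinM.
    have [_ [kj _] _ _ _] := Hrk j.
    rewrite ge0_integralZl_EFin ?sqrtr_ge0//.
    + by rewrite integral_expR_norm// -EFinM.
    + apply/measurable_EFinP; apply: measurableT_comp => //.
      apply: measurable_funM => //.
      by apply: measurableT_comp => //; exact: measurable_funB.
  - by move=> j; have [_ [_ kj] _ _ _] := Hrk j.
  - by move=> j t; have [_ _ + _ _] := Hrk j; exact.
  - by move=> j t; have [_ _ _ + _] := Hrk j; exact.
  - by move=> j t; have [_ _ _ _] := Hrk j; exact.
  - move=> v Hv; have := Hdl v; rewrite ler_norml => HH.
    have /andP[] : - (th * prior beta0) <= prior v - prior beta0 <= th * prior beta0.
      apply: HH => j; apply: le_trans (Hv j) _.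
      by have [] := Hrk j.
    by move=> ? ?; apply/andP; split; lra.
  - by rewrite errE (le_trans thB)// ge_min lexx.
rewrite errE => main; rewrite /tvdist.
have i0 : (0 <= intRp (fun v => `|posterior nu h prior H v -
    gaussdens nu h beta0 H v|%:E))%E.
  by apply: intRk_ge0 => v; rewrite lee_fin.
have th6 : th * B <= eps / 6 by rewrite (le_trans thB)// ge_min lexx orbT.
apply: (@le_trans _ _ (1%:E * intRp (fun v => `|posterior nu h prior H v -
    gaussdens nu h beta0 H v|%:E))%E).
  by apply: lee_wpmul2r => //; rewrite lee_fin; lra.
by rewrite mul1e (le_trans main)// lee_fin; lra.
Qed.

End deterministic.

(** * Passage to convergence in probability *)

(** For [|x| <= r] the cubic error is absorbed in the quadratic term; this supplies the curvature
    constant [K] of the deviation bound. *)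
Lemma quadratic_of_cubic_bound (R : realType) (d s c r x : R) : 0 <= c ->
  `|x| <= r -> `|d - s / 2 * x ^+ 2| <= c * `|x| ^+ 3 ->
  d <= (s / 2 + c * r) * x ^+ 2.
Proof.
move=> c0 xr; rewrite ler_norml => /andP[_ H].
have h1 : c * `|x| ^+ 3 <= c * r * x ^+ 2.
  rewrite -mulrA ler_wpM2l// -[x ^+ 2]real_normK ?num_real// exprS.
  by rewrite ler_wpM2r// exprn_ge0.
by rewrite mulrDl; lra.
Qed.

Theorem theorem3 (R : realType) (p : nat)
  (nu : {measure set R -> \bar R}) (h : R -> R)
  (beta0 : 'I_p -> R) (Lambda : history R p -> 'I_p -> R)
  (prior : ('I_p -> R) -> R) :
  (* exponential family: h is a nonnegative measurable carrier density *)
  (forall y, 0 <= h y) -> measurable_fun setT h ->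
  (* sampling rule: a (measurable) probability distribution on the arms *)
  (forall H i, 0 <= Lambda H i) ->
  (forall H, \sum_(i < p) Lambda H i = 1) ->
  (forall n (a : n.-tuple 'I_p) i,
      measurable_fun setT (fun y : n.-tuple R => Lambda (zip a y) i)) ->
  (* (i) true parameters in the interior of the natural parameter space *)
  (forall i, (natparam nu h)° (beta0 i)) ->
  (* nondegeneracy: I_n is invertible, i.e. b''(beta0_i) > 0 *)
  (forall i, 0 < derive1 (derive1 (logpart nu h)) (beta0 i)) ->
  (* (ii) min_i N_{n,i} -> oo in probability *)
  (forall M : nat,
      probH nu h beta0 Lambda n
        (fun H => [exists i, (npulls H i <= M)%N]) @[n --> \oo] --> 0%E) ->
  (* (iii) prior: continuous bounded probability density, positive at beta0,
     supported in the product of natural parameter spaces *)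
  (forall beta, 0 <= prior beta) ->
  continuous (prior : prod_topology (fun _ : 'I_p => R) -> R) ->
  (exists M : R, forall beta, prior beta <= M) ->
  intRp (fun beta => (prior beta)%:E) = 1%E ->
  (forall beta, prior beta != 0 -> forall i, natparam nu h (beta i)) ->
  0 < prior beta0 ->
  (* conclusion: TV(posterior, N(betahat_n, I_n^{-1})) -> 0 in probability *)
  forall eps : R, 0 < eps ->
    probH nu h beta0 Lambda n
      (fun H => (eps%:E < tvdist nu h beta0 prior H)%E) @[n --> \oo] --> 0%E.
Proof.
move=> h0 mh Lambda0 Lambda1 mLambda Nint s20 Npulls prior0 cprior priorM
  int_prior prior_supp prior_beta0 eps eps0.
(* The sampling weights sum to one, so there is an arm; its positive [b''] makes the partition
   function positive. *)
have i0 : 'I_p.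
  case: p beta0 Lambda prior Lambda1 {Lambda0 mLambda Nint s20 Npulls prior0
    cprior priorM int_prior prior_supp prior_beta0} => [|q] _ Lambda _ Lambda1.
    by have := Lambda1 [::]; rewrite big_ord0 => /eqP; rewrite eq_sym oner_eq0.
  exact: ord0.
have Zgt0 : forall eta, (0 < \int[nu]_y (expR (eta * y) * h y)%:E)%E.
  by apply: (partition_gt0 h0 mh (eta := beta0 i0)); rewrite gt_eqF.
have f0 := efdens_ge0 nu h0; have mf := fun eta => measurable_efdens nu mh eta.
have f1 := integral_efdens h0 mh Zgt0; have fD := efdensD nu h.
have /choice[C /choice[r Htaylor]] := fun i => logpart_taylor f0 mf f1 fD (Nint i).
have C_ge0 i : 0 <= C i by have [] := Htaylor i.
have r_gt0 i : 0 < r i by have [] := Htaylor i.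
have taylor i x : `|x| <= r i -> natparam nu h (beta0 i + x) /\
    `|logpart nu h (beta0 i + x) - logpart nu h (beta0 i)
      - derive1 (logpart nu h) (beta0 i) * x
      - derive1 (derive1 (logpart nu h)) (beta0 i) / 2 * x ^+ 2| <= C i * `|x| ^+ 3.
  by move=> xr; have [_ _] := Htaylor i; exact.
pose K i := derive1 (derive1 (logpart nu h)) (beta0 i) / 2 + C i * r i.
have K_ge0 i : 0 <= K i.
  apply: addr_ge0; last by apply: mulr_ge0 => //; exact: ltW.
  by apply: divr_ge0 => //; exact/ltW/s20.
have bK i x : `|x| <= r i -> natparam nu h (beta0 i + x) /\
    logpart nu h (beta0 i + x) - logpart nu h (beta0 i)
    - derive1 (logpart nu h) (beta0 i) * x <= K i * x ^+ 2.
  move=> xr; have [Nx tx] := taylor i x xr; split => //.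
  exact: quadratic_of_cubic_bound (C_ge0 i) xr tx.
have convex i x t : natparam nu h (beta0 i + x) ->
    natparam nu h (beta0 i + t * x) -> 0 <= t <= 1 ->
    logpart nu h (beta0 i + t * x) - logpart nu h (beta0 i) <=
    t * (logpart nu h (beta0 i + x) - logpart nu h (beta0 i)).
  have N0 : natparam nu h (beta0 i).
    by rewrite -[beta0 i]addr0; apply: (taylor i 0 _).1; rewrite normr0 ltW.
  exact: (@logpart_convex R nu (natparam nu h) (logpart nu h) (efdens nu h)
    f0 mf f1 fD (beta0 i) x t N0).
have [M1 HM1] := tvdist_le_eps s20 C_ge0 r_gt0 K_ge0 taylor convex prior0 cprior
  priorM prior_supp prior_beta0 eps0.
(* A root [q] above both 1 and [1 / r i] has [q^-2 <= r i], so the tilts are admissible. *)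
have /choice[M2 HM2] := fun i => exists_root5_ge (Num.max 1 (r i)^-1).
have bad_le M n : (0 < M)%N -> (M1 <= M)%N -> (forall i, M2 i <= M)%N ->
  (probH nu h beta0 Lambda n (fun H => (eps%:E < tvdist nu h beta0 prior H)%E) <=
   probH nu h beta0 Lambda n (fun H => [exists i, (npulls H i <= M)%N]) +
   (2 * p%:R * (10 ^+ 10 / M%:R))%:E)%E.
  move=> M0 M1M M2M.
  apply: le_trans _ (probH_deviates h0 mh Lambda0 Lambda1 Zgt0 r_gt0 bK n M0 _).
    apply: le_histE => // H _; rewrite lee_fin ler_nat.
    case: (boolP (_ < _)%E) => // tv; rewrite lt0b.
    apply: contraT; rewrite negb_or !negb_exists => /andP[/forallP NM /forallP dev].
    move: tv; rewrite ltNge HM1// => i.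
    by apply: leq_ltn_trans M1M _; rewrite ltnNge.
  move=> i m Mm; have := HM2 i m (leq_ltn_trans (M2M i) Mm).
  rewrite ge_max => /andP[q1 qr]; have q0 : 0 < root5 R m by lra.
  split => //; rewrite -[leRHS]invrK lef_pV2 ?posrE ?exprn_gt0 ?invr_gt0//.
  by apply: le_trans qr _; rewrite expr2 ler_peMl// ltW.
have bad0 n E : (0 <= probH nu h beta0 Lambda n E)%E.
  by apply: histE_ge0 => // H; rewrite lee_fin ler0n.
have eventually_small (eta : R) : 0 < eta -> \forall n \near \oo,
  (probH nu h beta0 Lambda n (fun H => (eps%:E < tvdist nu h beta0 prior H)%E) <=
   eta%:E)%E.
  move=> eta0.
  pose A : R := 2 * p%:R * 10 ^+ 10.
  have A0 : 0 <= A by rewrite mulr_ge0 ?exprn_ge0// mulr_ge0.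
  (* [M] is fixed before [n]: it makes the deviation error at most [eta / 2] uniformly in [n], and
     the other half comes from the pull-count hypothesis at this [M]. *)
  pose M := maxn 1 (maxn (maxn M1 (\max_i M2 i)) (Num.truncn (A / (eta / 2))).+1).
  have M0 : (0 < M)%N by rewrite leq_max.
  have M1M : (M1 <= M)%N by rewrite !leq_max leqnn !orbT.
  have M2M i : (M2 i <= M)%N by rewrite !leq_max (leq_bigmax i) !orbT.
  have AM : A / M%:R <= eta / 2.
    have : (Num.truncn (A / (eta / 2))).+1%:R <= M%:R :> R.
      by rewrite ler_nat !leq_max leqnn !orbT.
    move=> /(lt_le_trans (truncnS_gt _)) /ltW.
    by rewrite ler_pdivrMr ?divr_gt0// ler_pdivrMr ?ltr0n// mulrC.
  have /fine_cvgP[fin /cvgrPdist_le/(_ (eta / 2))] := Npulls M.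
  rewrite divr_gt0// => /(_ isT) lim0; near=> n.
  apply: le_trans (bad_le M n M0 M1M M2M) _.
  have fn : probH nu h beta0 Lambda n (fun H => [exists i, (npulls H i <= M)%N])
    \is a fin_num by near: n.
  have : `|0 - fine (probH nu h beta0 Lambda n
      (fun H => [exists i, (npulls H i <= M)%N]))| <= eta / 2 by near: n.
  rewrite sub0r normrN => /(le_trans (ler_norm _)) small.
  rewrite -(fineK fn) -EFinD lee_fin.
  by move: AM; rewrite /A mulrA; lra.
apply/fine_cvgP; split.
  near=> n; rewrite ge0_fin_numE//.
  apply: (@le_lt_trans _ _ 1%:E); last exact: ltry.
  by near: n; exact: eventually_small.
apply/cvgrPdist_le => eta eta0; near=> n.
have small : (probH nu h beta0 Lambda n
  (fun H => (eps%:E < tvdist nu h beta0 prior H)%E) <= eta%:E)%E.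
  by near: n; exact: eventually_small.
rewrite sub0r normrN ger0_norm ?fine_ge0//=.
rewrite -lee_fin fineK// ge0_fin_numE//.
exact: le_lt_trans small (ltry _).
Unshelve. all: by end_near. Qed.
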